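(* Let $a_{N,T}$ be a positive sequence and set $\lambda_{N,T}=4a_{N,T}p^{1/r}(NT)^{1/2}\max_{1\le t\le T}\|\epsilon_{1,t}\|_{L_r}$ and $\mu_{N,T}=4a_{N,T}N^{1/r}T^{1/2}\max_{1\le t\le T}\|\epsilon_{1,t}\|_{L_r}$. Under assumptions (A1) and (A2a), $$P\left(\kappa^2_{\Psi_{N,T}}\ge\kappa^2/2\right)\ge P(\tilde{\mathcal{B}}_{N,T})\ge1-D_r\frac{(p^2+Np)(s_1+s_2)^{r/2}\left(\frac pN\vee\frac Np\right)}{\kappa^rN^{r/4}}$$ for a constant $D_r$ depending only on $r$.
   Context: For $i=1,\dots,N$, $t=1,\dots,T$ let $x_{i,t}=(x_{i,t,1},\dots,x_{i,t,p})'\in\mathbb{R}^p$ be random covariates and $\epsilon_{i,t}$ random errors in the panel model $y_{i,t}=x_{i,t}'\beta^*+c_i^*+\epsilon_{i,t}$ with deterministic $\beta^*\in\mathbb{R}^p$, $c^*\in\mathbb{R}^N$; $s_1=|\{j:\beta_j^*\ne0\}|$, $s_2=|\{i:c_i^*\neq0\}|$. Put $X_i=(x_{i,1},\dots,x_{i,T})'$, $X=(X_1',\dots,X_N')'$, $\epsilon_i=(\epsilon_{i,1},\dots,\epsilon_{i,T})'$, $D=I_N\otimes\iota$ with $\iota$ the $T\times1$ vector of ones, $Z=(X,D)$, $S=\mathrm{diag}(\sqrt{NT}\,I_p,\sqrt T\,I_N)$, $\Psi_{N,T}=S^{-1}Z'ZS^{-1}$ and $\Gamma=\mathrm{diag}(E(X'X/(NT)),I_N)$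 (block diagonal). $\|\cdot\|$, $\|\cdot\|_{\ell_1}$ are the $\ell_2$- and $\ell_1$-norms; $\|U\|_{L_r}=(E|U|^r)^{1/r}$; $a\vee b=\max(a,b)$; $v_A$ is the subvector indexed by $A$. For a positive semi-definite $(p+N)\times(p+N)$ matrix $M$ let $\kappa_M^2$ be the minimum of $\delta'M\delta/\|\delta\|^2$ over all $\delta=({\delta^1}',{\delta^2}')'\in\mathbb{R}^{p+N}\setminus\{0\}$ ($\delta^1\in\mathbb{R}^p$, $\delta^2\in\mathbb{R}^N$) and all $R_1\subseteq\{1,\dots,p\}$, $R_2\subseteq\{1,\dots,N\}$ with $|R_1|\le s_1$, $|R_2|\le s_2$ and $\frac{\lambda_{N,T}}{\sqrt{NT}}\|\delta^1_{R_1^c}\|_{\ell_1}+\frac{\mu_{N,T}}{\sqrt T}\|\delta^2_{R_2^c}\|_{\ell_1}\le 3\frac{\lambda_{N,T}}{\sqrt{NT}}\|\delta^1_{R_1}\|_{\ell_1}+3\frac{\mu_{N,T}}{\sqrt T}\|\delta^2_{R_2}\|_{\ell_1}$. Write $\kappa^2=\kappa^2_\Gamma$, $\kappa=\sqrt{\kappa^2}$. $\tilde{\mathcal{B}}_{N,T}=\left\{\max_{1\le i,j\le p+N}|(\Psi_{N,T})_{i,j}-\Gamma_{i,j}|\le\frac{\kappa^2}{32(s_1+s_2)m_{N,T}^2}\right\}$, where $m_{N,T}=\frac{\lambda_{N,T}}{\sqrt N\mu_{N,T}}\vee\frac{\sqrt N\mu_{N,T}}{\lambda_{N,T}}$. (A1):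 (a) $\{(X_i,\epsilon_i)\}_{i=1}^N$ are independent and identically distributed; (b) $X_i$ and $\epsilon_i$ are independent for each $i$; (c) for each $i$, $\{\epsilon_{i,t},\mathcal{F}_{i,t}\}_{t=1}^T$ with $\mathcal{F}_{i,t}=\sigma(\epsilon_{i,1},\dots,\epsilon_{i,t})$ is a martingale difference sequence. (A2a): for some $r\ge2$, $E|x_{1,t,k}|^r<\infty$ and $E|\epsilon_{1,t}|^r<\infty$ for all $t=1,\dots,T$, $k=1,\dots,p$, with $\max_{1\le t\le T}E|x_{1,t,k}|^r\le1$ for all $k$. *)

(* Defs.v *)
From HB Require Import structures.
From mathcomp Require Import all_boot all_order all_algebra.
From mathcomp Require Import mxtens.
From mathcomp Require Import all_classical all_reals all_analysis.

Set Implicit Arguments.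
Unset Strict Implicit.
Unset Printing Implicit Defensive.

Import Order.TTheory GRing.Theory Num.Theory.
Import numFieldNormedType.Exports.

Local Open Scope classical_set_scope.
Local Open Scope ring_scope.

Section Probability.
Context {R : realType} {d : measure_display} {Omega : measurableType d}.
Variable P : probability Omega R.

Definition mutually_independent (I : finType) (d' : measure_display)
    (E : measurableType d') (Y : I -> Omega -> E) : Prop :=
  forall (J : {set I}) (B : I -> set E),
    (forall i, i \in J -> measurable (B i)) ->
    P (\bigcap_(i in [set` J]) (Y i @^-1` B i)) =
      (\prod_(i in J) P (Y i @^-1` B i))%E.

Definition identically_distributed (I : Type) (d' : measure_display)
    (E : measurableType d') (Y : I -> Omega -> E) : Prop :=
  forall (i j : I) (B : set E), measurable B ->
    P (Y i @^-1` B) = P (Y j @^-1` B).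

Definition independent2 (d1 d2 : measure_display)
    (E1 : measurableType d1) (E2 : measurableType d2)
    (U : Omega -> E1) (V : Omega -> E2) : Prop :=
  forall (A : set E1) (B : set E2), measurable A -> measurable B ->
    P ((U @^-1` A) `&` (V @^-1` B)) = (P (U @^-1` A) * P (V @^-1` B))%E.

Definition sub_measurable (G : set (set Omega)) (V : Omega -> R) : Prop :=
  forall B : set R, measurable B -> G (V @^-1` B).

(* V is a version of E[U | G]. *)
Definition is_cond_expectation (G : set (set Omega)) (U V : Omega -> R) : Prop :=
  [/\ sub_measurable G V,
      P.-integrable setT (EFin \o V) &
      forall A : set Omega, G A ->
        (\int[P]_(w in A) (V w)%:E = \int[P]_(w in A) (U w)%:E)%E].

(* The sigma-algebra generated by the first [n] variables; it is trivial for
   [n = 0]. *)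
Definition natural_filtration (T : nat) (e : 'I_T -> Omega -> R) (n : nat) :
    set (set Omega) :=
  <<s \bigcup_(t in [set t : 'I_T | (t < n)%N])
        preimage_set_system setT (e t) measurable >>.

(* Times are 0-based: the sigma-algebra current at time [t : 'I_T] is [F t.+1]
   and the preceding one is [F t]. *)
Definition martingale_difference (T : nat) (e : 'I_T -> Omega -> R)
    (F : nat -> set (set Omega)) : Prop :=
  forall t : 'I_T,
    [/\ sub_measurable (F t.+1) (e t),
        P.-integrable setT (EFin \o e t) &
        is_cond_expectation (F t) (e t) (cst 0)].

Definition normL (r : R) (U : Omega -> R) : R :=
  fine ('N[P]_(r%:E)[EFin \o U])%E.

End Probability.

Section Model.
Context {R : realType} {d : measure_display} {Omega : measurableType d}.
Variable P : probability Omega R.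
Variables (N T p : nat).
Variable x : 'I_N -> 'I_T -> 'I_p -> {RV P >-> R}.
Variable eps : 'I_N -> 'I_T -> {RV P >-> R}.

Definition panel_model (y : 'I_N -> 'I_T -> {RV P >-> R})
    (beta : 'cV[R]_p) (c : 'cV[R]_N) : Prop :=
  forall i t w,
    y i t w = \sum_(k < p) x i t k w * beta k ord0 + c i ord0 + eps i t w.

(* X_i and eps_i as random elements of the product measurable spaces
   R^(T x p) and R^T. *)
Definition x_elt (i : 'I_N) (w : Omega) : T.-tuple (p.-tuple R) :=
  [tuple [tuple x i t k w | k < p] | t < T].

Definition eps_elt (i : 'I_N) (w : Omega) : T.-tuple R :=
  [tuple eps i t w | t < T].

Definition assumption_A1 : Prop :=
  [/\ mutually_independent P (fun i w => (x_elt i w, eps_elt i w)) /\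
        identically_distributed P (fun i w => (x_elt i w, eps_elt i w)),
      forall i, independent2 P (x_elt i) (eps_elt i) &
      forall i, martingale_difference P (fun t => eps i t)
                  (natural_filtration (fun t => eps i t))].

Definition assumption_A2a (i1 : 'I_N) (r : R) : Prop :=
  [/\ forall t k, ('E_P[fun w => (`|x i1 t k w| `^ r)%R] < +oo)%E,
      forall t, ('E_P[fun w => (`|eps i1 t w| `^ r)%R] < +oo)%E &
      forall k, (\big[maxe/0]_(t < T) 'E_P[fun w => (`|x i1 t k w| `^ r)%R] <= 1)%E].

(* max_t ||eps_{1,t}||_{L_r} *)
Definition max_normL_eps (i1 : 'I_N) (r : R) : R :=
  \big[Num.max/0]_(t < T) normL P r (eps i1 t).

Definition lambdaNT (i1 : 'I_N) (r a : R) : R :=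
  4 * a * p%:R `^ r^-1 * Num.sqrt (N * T)%:R * max_normL_eps i1 r.

Definition muNT (i1 : 'I_N) (r a : R) : R :=
  4 * a * N%:R `^ r^-1 * Num.sqrt T%:R * max_normL_eps i1 r.

Definition Xmx (w : Omega) : 'M[R]_(N * T, p) :=
  \matrix_(h, k) x (mxtens_unindex h).1 (mxtens_unindex h).2 k w.

(* I_N (x) iota, whose number of columns is [N * 1] *)
Definition Dmx : 'M[R]_(N * T, N) :=
  castmx (erefl, muln1 N) (tensmx (1%:M : 'M[R]_N) (const_mx 1 : 'cV[R]_T)).

Definition Zmx (w : Omega) : 'M[R]_(N * T, p + N) := row_mx (Xmx w) Dmx.

Definition Smx : 'M[R]_(p + N) :=
  block_mx (Num.sqrt (N * T)%:R)%:M 0 0 (Num.sqrt T%:R)%:M.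

Definition Psi (w : Omega) : 'M[R]_(p + N) :=
  invmx Smx *m (Zmx w)^T *m Zmx w *m invmx Smx.

Definition Gamma : 'M[R]_(p + N) :=
  block_mx
    (\matrix_(k, l)
       fine ('E_P[fun w => (((Xmx w)^T *m Xmx w) k l / (N * T)%:R)%R])%E) 0
    0 1%:M.

End Model.

Section RestrictedEigenvalue.
Context {R : realType}.

Definition supp (n : nat) (v : 'cV[R]_n) : {set 'I_n} :=
  [set j | v j ord0 != 0].

Definition norm2 (n : nat) (v : 'cV[R]_n) : R :=
  Num.sqrt (\sum_(j < n) v j ord0 ^+ 2).

(* l1-norm of the subvector indexed by [A] *)
Definition norm1 (n : nat) (A : {set 'I_n}) (v : 'cV[R]_n) : R :=
  \sum_(j in A) `|v j ord0|.

Definition restricted_cone (N T p s1 s2 : nat) (lambda mu : R)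
    (delta : 'cV[R]_(p + N)) (R1 : {set 'I_p}) (R2 : {set 'I_N}) : Prop :=
  [/\ (#|R1| <= s1)%N, (#|R2| <= s2)%N &
      lambda / Num.sqrt (N * T)%:R * norm1 (~: R1)%SET (usubmx delta) +
        mu / Num.sqrt T%:R * norm1 (~: R2)%SET (dsubmx delta) <=
      3 * (lambda / Num.sqrt (N * T)%:R) * norm1 R1 (usubmx delta) +
        3 * (mu / Num.sqrt T%:R) * norm1 R2 (dsubmx delta)].

(* The infimum is attained unless the constraint set is empty, which can only
   happen when [s1 = s2 = 0]; the value is then [inf set0 = 0]. *)
Definition kappa2 (N T p s1 s2 : nat) (lambda mu : R) (M : 'M[R]_(p + N)) : R :=
  inf [set q | exists (delta : 'cV[R]_(p + N)) (R1 : {set 'I_p})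
                      (R2 : {set 'I_N}),
        [/\ delta != 0, restricted_cone T s1 s2 lambda mu delta R1 R2 &
            q = (delta^T *m M *m delta) ord0 ord0 / norm2 delta ^+ 2]].

Definition mNT (N : nat) (lambda mu : R) : R :=
  Num.max (lambda / (Num.sqrt N%:R * mu)) (Num.sqrt N%:R * mu / lambda).

End RestrictedEigenvalue.

Definition Btilde {R : realType} {d : measure_display}
    {Omega : measurableType d} (P : probability Omega R) (N T p : nat)
    (x : 'I_N -> 'I_T -> 'I_p -> {RV P >-> R}) (s1 s2 : nat)
    (lambda mu : R) : set Omega :=
  [set w | \big[Num.max/0]_(ij : 'I_(p + N) * 'I_(p + N))
             `|Psi x w ij.1 ij.2 - Gamma x ij.1 ij.2| <=
           kappa2 T s1 s2 lambda mu (Gamma x) /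
             (32 * (s1 + s2)%:R * mNT N lambda mu ^+ 2)].

(* Main.v *)
Require Import Defs.
From HB Require Import structures.
From mathcomp Require Import all_boot all_order all_algebra.
From mathcomp Require Import mxtens.
From mathcomp Require Import all_classical all_reals all_analysis.
From mathcomp Require Import measurable_realfun ring lra.

Set Implicit Arguments.
Unset Strict Implicit.
Unset Printing Implicit Defensive.

Import Order.TTheory GRing.Theory Num.Theory.
Import numFieldNormedType.Exports.

Local Open Scope classical_set_scope.
Local Open Scope ring_scope.

(** The inequality between the two probabilities comes from an inclusion of
    events.  On the restricted cone the l1-norm of a vector is at most
    [4 m sqrt (s1 + s2)] times its l2-norm ([cone_l1_le]): the cone condition
    compares the two blocks through the weights [lambda / sqrt (N T)] and
    [mu / sqrt T], whose ratio, taken in the larger direction, is [m].  A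
    quadratic form changes by at most [e] times the squared l1-norm when the
    entries of its matrix change by at most [e], so on the event [Btilde] the
    restricted eigenvalue of [Psi] is below that of [Gamma] by at most
    [16 (s1 + s2) m ^ 2 / (32 (s1 + s2) m ^ 2) = 1 / 2] of the latter
    ([Btilde_sub]).  The comparison of probabilities also requires both events
    to be measurable; the restricted eigenvalue is an infimum over an
    uncountable set, but it is a Lipschitz function of the matrix, and its level
    sets are therefore countable combinations of measurable sets
    ([measurable_lipschitz_ge]).

    For the lower bound, put [q = r / 2] and let [t] be the threshold in
    [Btilde].  The entries of [Psi - Gamma] are
    - averages over [i < N] of independent centered variables whose moments of
      order [q] are bounded, in the block of the covariates ([p ^ 2] entries);
    - [sqrt N ^-1] times averages over [t < T] of covariates, off the diagonal
      blocks ([N p] entries, up to symmetry);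
    - zero in the block of the individual effects.

    When [4 <= r], both kinds of entries exceed [t] with probability at most a
    constant times [N ^ (- r / 4) t ^ (- r / 2)], by Markov's inequality of order
    [q]; for the first kind the moment of the sum is bounded by
    [marcinkiewicz_zygmund].  The union bound and
    [m ^ r = max (p / N) (N / p)] ([mNT_powR]) give the claim.  When [r < 4] the
    moment inequality of order [q < 2] would lose a power of [N], but there the
    lower bound is not positive: [kappa ^ 2 <= 2] because the diagonal of [Gamma]
    is bounded by [2] ([kappa2_le_diag]), and
    [(p ^ 2 + N p) max (p / N) (N / p) >= N ^ 2], which exceeds [N ^ (r / 4)].

    The moment inequality is proved by adding the summands one at a time.  The
    second-order Taylor bound [powR_taylor] for [|s| ^ q] has a linear term whose
    expectation vanishes by independence, and the quadratic term, once the factor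
    [|s| ^ (q - 2)] is split at the scale [sqrt n], contributes an amount
    comparable to the increment of [n ^ (q / 2)].  The independence of a summand
    from the sum of the others is obtained from the product rule by a pi-lambda
    argument ([independent2_sum]), and expectations of products factor through
    Fubini's theorem ([independent2_expectM]). *)

(** * Power inequalities for real numbers *)

Section Scalar.
Context {R : realType}.
Implicit Types (a b q s t u v : R).

(** Both factors of [v (expR v - 1)] are controlled by [1 + v <= expR v], applied
    to [v] and to [- v]. *)
Lemma expR_le_quad v : expR v <= 1 + v + v ^+ 2 * expR `|v|.
Proof.
have e0 := expR_gt0 v.
have e1 : expR v - 1 <= v * expR v.
  have /(ler_wpM2l (ltW e0)) := expR_ge1Dx (- v).
  by rewrite expRN divff ?gt_eqF// => h; lra.
have e2 : 1 + v <= expR v := expR_ge1Dx v.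
have [v0|v0] := leP 0 v.
  by rewrite ger0_norm//; nra.
have e3 : 1 <= expR `|v| by rewrite -[leLHS](@expR0 R) ler_expR.
by nra.
Qed.

Lemma powR_sqrM a q : 0 < a -> a `^ q = a ^+ 2 * a `^ (q - 2).
Proof.
move=> a0; rewrite -powR_mulrn ?(ltW a0)// -powRD; last by rewrite (gt_eqF a0) implybT.
by congr (_ `^ _); ring.
Qed.

(** The first summand serves increments smaller than the base point, the other
    two serve larger increments. *)
Definition taylor_const q : R := q ^+ 2 * expR q + 2 `^ q + q.

Lemma taylor_const_ge1 q : 2 <= q -> 1 <= taylor_const q.
Proof.
by rewrite /taylor_const; have := expR_gt0 q; have := powR_ge0 2 q; nra.
Qed.

(** For [`|b| <= a] the bound is homogeneous, and [1 + u <= expR u] with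
    [u = b / a] turns the real power into an exponential, for which
    [expR_le_quad] applies.  For [a < `|b|] every term is dominated by
    [`|b| `^ q]. *)
Lemma powR_taylor_pos q a b : 2 <= q -> 0 < a ->
  `|a + b| `^ q <= a `^ q + q * (b * a `^ (q - 1)) +
     taylor_const q * (a `^ (q - 2) * b ^+ 2 + `|b| `^ q).
Proof.
move=> q2 a0; have q0 : 0 <= q by lra.
have aq1 : a * a `^ (q - 1) = a `^ q by rewrite mulr_powRB1//; lra.
have aq2 := powR_sqrM q a0.
have ha2 : 0 <= a `^ (q - 2) by exact: powR_ge0.
have ha1 : 0 <= a `^ (q - 1) by exact: powR_ge0.
have hb : 0 <= `|b| `^ q by exact: powR_ge0.
have h2 : 0 <= 2 `^ q :> R by exact: powR_ge0.
have eq0 := expR_gt0 q.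
have C1 : q ^+ 2 * expR q <= taylor_const q by rewrite /taylor_const; lra.
have C2 : 2 `^ q + q <= taylor_const q by rewrite /taylor_const; nra.
have C0 : 0 <= taylor_const q by lra.
have [ba|ab] := leP `|b| a.
  pose u := b / a.
  have bE : b = a * u by rewrite /u mulrC divfK ?gt_eqF.
  have u1 : `|u| <= 1 by rewrite /u normrM normfV (gtr0_norm a0) ler_pdivrMr ?mul1r.
  have u1' : 0 <= 1 + u by move: u1; rewrite ler_norml => /andP[]; lra.
  have -> : a + b = a * (1 + u) by rewrite bE; ring.
  rewrite ger0_norm ?mulr_ge0 ?(ltW a0)// powRM ?(ltW a0)//.
  have h : (1 + u) `^ q <= 1 + q * u + (q * u) ^+ 2 * expR q.
    apply: (@le_trans _ _ (expR (q * u))).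
      rewrite [q * u]mulrC expRM; apply: ge0_ler_powR => //; rewrite ?nnegrE ?expR_ge0//.
      exact: expR_ge1Dx.
    apply: (le_trans (expR_le_quad _)); rewrite lerD2l ler_wpM2l ?sqr_ge0// ler_expR.
    by rewrite normrM (ger0_norm q0) ler_piMr.
  apply: (le_trans (ler_wpM2l (powR_ge0 _ _) h)).
  have e1 : q * (b * a `^ (q - 1)) = q * u * a `^ q by rewrite bE -aq1; ring.
  have e2 : a `^ (q - 2) * b ^+ 2 = u ^+ 2 * a `^ q.
    by rewrite bE aq2; ring.
  rewrite e1 e2.
  have := ler_wpM2r (mulr_ge0 (sqr_ge0 u) (powR_ge0 a q)) C1.
  have : 0 <= taylor_const q * `|b| `^ q by rewrite mulr_ge0//; lra.
  by lra.
have -> : `|b| `^ q = `|b| * `|b| `^ (q - 1) by rewrite mulr_powRB1//; lra.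
have h1 : `|a + b| `^ q <= 2 `^ q * (`|b| * `|b| `^ (q - 1)).
  rewrite mulr_powRB1// ?normr_ge0//; last by lra.
  rewrite -powRM//; apply: ge0_ler_powR => //; rewrite ?nnegrE ?mulr_ge0//.
  by apply: (le_trans (ler_normD _ _)); rewrite (gtr0_norm a0); lra.
have h3 : a `^ (q - 1) <= `|b| `^ (q - 1).
  by apply: ge0_ler_powR; rewrite ?nnegrE ?(ltW a0) ?(ltW ab)//; lra.
have h4 : - (b * a `^ (q - 1)) <= `|b| * `|b| `^ (q - 1).
  apply: (@le_trans _ _ (`|b| * a `^ (q - 1))); last by rewrite ler_wpM2l.
  by rewrite -mulNr ler_wpM2r// -normrN ler_norm.
have h5 := ler_wpM2r (mulr_ge0 (normr_ge0 b) (powR_ge0 `|b| (q-1))) C2.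
have h6 : 0 <= taylor_const q * (a `^ (q - 2) * b ^+ 2).
  exact: mulr_ge0 C0 (mulr_ge0 ha2 (sqr_ge0 b)).
have h7 := ler_wpM2l q0 h4.
have h8 : 0 <= a `^ q by exact: powR_ge0.
by lra.
Qed.

(** The derivative of [`|s| `^ q / q] is written [a * `|a| `^ (q - 2)], which is
    odd in [a]; this reduces the bound to a positive base point. *)
Lemma powR_taylor q a b : 2 <= q ->
  `|a + b| `^ q <= `|a| `^ q + q * (a * `|a| `^ (q - 2) * b) +
     taylor_const q * (`|a| `^ (q - 2) * b ^+ 2 + `|b| `^ q).
Proof.
move=> q2.
have pos a' b' : 0 < a' -> `|a' + b'| `^ q <= a' `^ q +
     q * (a' * a' `^ (q - 2) * b') +
     taylor_const q * (a' `^ (q - 2) * b' ^+ 2 + `|b'| `^ q).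
  move=> a0; have -> : q - 2 = (q - 1) - 1 by ring.
  rewrite mulr_powRB1 ?(ltW a0)//; last by lra.
  rewrite [_ * b']mulrC; have -> : q - 1 - 1 = q - 2 by ring.
  exact: powR_taylor_pos.
have [a0|a0|->] := ltrgt0P a.
- exact: pos.
- have /(@pos _ (- b)) : 0 < - a by rewrite oppr_gt0.
  rewrite -opprD !normrN sqrrN.
  by have -> : - a * (- a) `^ (q - 2) * - b = a * (- a) `^ (q - 2) * b by ring.
- rewrite !mul0r mulr0 add0r powR0 ?add0r; last by rewrite gt_eqF//; lra.
  have h : 0 <= `|b| `^ q by exact: powR_ge0.
  have h' : 0 <= 0 `^ (q - 2) * b ^+ 2 by rewrite mulr_ge0 ?powR_ge0 ?sqr_ge0.
  by have := taylor_const_ge1 q2; nra.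
Qed.

(** The lower-order power is traded for the power [q] at a free scale [t]: the
    first term serves [`|s| <= t] and the second one [t < `|s|]. *)
Lemma powR_split q s t : 2 <= q -> 0 < t ->
  `|s| `^ (q - 2) <= t `^ (q - 2) + `|s| `^ q / t ^+ 2.
Proof.
move=> q2 t0; have [st|ts] := leP `|s| t.
  rewrite ler_wpDr// ?divr_ge0 ?powR_ge0 ?sqr_ge0//.
  by apply: ge0_ler_powR; rewrite ?nnegrE ?(ltW t0)//; lra.
rewrite ler_wpDl ?powR_ge0// ler_pdivlMr ?exprn_gt0//.
rewrite (powR_sqrM q (lt_trans t0 ts)) mulrC ler_wpM2r ?powR_ge0//.
by rewrite lerXn2r ?nnegrE ?normr_ge0 ?(ltW t0) ?(ltW ts).
Qed.

Lemma powR_normD_le q a b : 0 <= q ->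
  `|a + b| `^ q <= 2 `^ q * (`|a| `^ q + `|b| `^ q).
Proof.
move=> q0.
wlog ab : a b / `|a| <= `|b|.
  move=> H; have [/H//|/ltW/H] := leP `|a| `|b|.
  by rewrite addrC [X in _ * X]addrC.
apply: (@le_trans _ _ ((2 * `|b|) `^ q)).
  apply: ge0_ler_powR => //; rewrite ?nnegrE ?mulr_ge0//.
  by apply: (le_trans (ler_normD _ _)); lra.
by rewrite powRM// ler_wpM2l ?powR_ge0// ler_wpDl ?powR_ge0.
Qed.

Lemma powR_le1D s a b : 0 <= a <= b -> `|s| `^ a <= 1 + `|s| `^ b.
Proof.
move=> /andP[a0 ab]; have [s1|s1] := leP `|s| 1.
  have h : `|s| `^ a <= 1 `^ a by apply: ge0_ler_powR; rewrite ?nnegrE.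
  by rewrite ler_wpDr ?powR_ge0// (le_trans h)// powR1.
by rewrite ler_wpDl// ler_powR// ltW.
Qed.

End Scalar.

(** * Independence and expectations of products *)

Section Independence.
Context {R : realType} {d : measure_display} {Omega : measurableType d}.
Variable P : probability Omega R.

Lemma mutually_independent_comp (I : finType) d1 (E : measurableType d1)
    d2 (F : measurableType d2)
    (Y : I -> Omega -> E) (f : I -> E -> F) :
  (forall i, measurable_fun setT (f i)) ->
  mutually_independent P Y ->
  mutually_independent P (fun i => f i \o Y i).
Proof.
move=> mf indY J B mB.
under eq_bigr do rewrite comp_preimage.
under eq_bigcapr do rewrite comp_preimage.
apply: indY => i iJ; rewrite -[X in measurable X]setTI.
by apply: mf => //; exact: mB.
Qed.

(** The finite measures [A |-> P (A `&` F)] and [A |-> P F * P A] agree on a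
    pi-system, hence on the sigma-algebra that it generates. *)
Lemma independent2_sigma (G : set (set Omega)) (F : set Omega) :
  G `<=` measurable -> setI_closed G -> G setT -> measurable F ->
  (forall A, G A -> P (A `&` F) = (P A * P F)%E) ->
  forall A, <<s G >> A -> P (A `&` F) = (P A * P F)%E.
Proof.
move=> mG IG GT mF GF A sA.
pose c : {nonneg R} := NngNum (fine_ge0 (measure_ge0 P F)).
have cE : c%:num%:E = P F by rewrite /c /= fineK// fin_num_measure.
have : mrestr P mF A = mscale c P A.
  apply: (@g_sigma_algebra_measure_unique _ _ _ G mG (fun=> setT)) => //.
  - by rewrite bigcup_const//; exists 0%N.
  - move=> B GB /=.
    change (P (B `&` F) = c%:num%:E * P B)%E.
    by rewrite cE muleC; exact: GF.
  - move=> _; change (P (setT `&` F) < +oo)%E.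
    by rewrite setTI (le_lt_trans (probability_le1 _ mF))// ltry.
by rewrite /mrestr /mscale/= => ->; rewrite fineK 1?muleC// fin_num_measure.
Qed.

(** The events that restrict each [W j], with [j] in [s], to a measurable set form
    a pi-system on which the product rule holds against events of [W i];
    the sum is measurable for the sigma-algebra generated by them. *)
Lemma independent2_sum (I : finType) (W : I -> Omega -> R) (s : seq I) i :
  (forall i, measurable_fun setT (W i)) ->
  mutually_independent P W -> i \notin s ->
  independent2 P (fun w => \sum_(j <- s) W j w) (W i).
Proof.
move=> mW indW is_ A B mA mB.
pose S := [set j | j \in s]%SET.
pose G := [set C : set Omega | exists2 D : I -> set R,
  (forall j, measurable (D j)) & C = \bigcap_(j in [set` S]) (W j @^-1` D j)].
have mWD j D : measurable D -> measurable (W j @^-1` D).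
  by move=> mD; rewrite -[X in measurable X]setTI; exact: mW.
have mF := mWD i B mB.
have mG : G `<=` measurable.
  move=> _ [D mD ->]; apply: fin_bigcap_measurable => // j _; exact: mWD.
apply: (@independent2_sigma G) => //.
- move=> _ _ [C mC ->] [D mD ->]; exists (fun j => C j `&` D j).
    by move=> j; exact: measurableI.
  by rewrite -bigcapI; apply: eq_bigcapr => j _; rewrite preimage_setI.
- by exists (fun=> setT) => //; rewrite bigcapT.
- move=> _ [D mD ->].
  have := indW (i |: S)%SET (fun j => if j == i then B else D j).
  have iS : i \notin S by rewrite inE.
  rewrite big_setU1//= eqxx.
  have e : \bigcap_(j in [set` (i |: S)%SET]) (W j @^-1` (if j == i then B else D j))
     = (\bigcap_(j in [set` S]) (W j @^-1` D j)) `&` W i @^-1` B.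
    apply/seteqP; split=> w /=.
      move=> H; split; last first.
        by have := H i; rewrite /= !inE eqxx; exact.
      move=> j /= jS; have := H j; rewrite /= !inE; move: jS; rewrite inE => jS.
      case: eqVneq => [ji|_]; first by move: is_; rewrite -ji jS.
      by apply; rewrite jS orbT.
    move=> [H1 H2] j /=; rewrite !inE.
    case: eqVneq => [-> _ //|_ /= js]; apply: H1 => /=; by rewrite inE.
  rewrite e => ->.
    rewrite muleC; congr (_ * _)%E.
    rewrite indW//; apply: eq_bigr => j jS.
    by case: eqVneq => // ji; move: iS; rewrite -ji jS.
  by move=> j _; case: eqVneq.
(* The sum is measurable when Omega carries the sigma-algebra of [G]. *)
- pose OG := g_sigma_algebraType G.
  have mWG j : j \in s -> measurable_fun [set: OG] (W j : OG -> R).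
    move=> js _ C mC; rewrite setTI; apply: sub_sigma_algebra.
    exists (fun k => if k == j then C else setT).
      by move=> k; case: eqVneq.
    apply/seteqP; split=> w /= H.
      by move=> k _ /=; case: eqVneq => [->|].
    by have := H j; rewrite /= inE eqxx; exact.
  have : measurable_fun [set: OG] (fun w : OG => \sum_(j <- s) W j w).
    under eq_fun do rewrite big_seq_cond big_mkcond/=.
    apply: measurable_sum => j; rewrite andbT.
    by have [/mWG//|_] := boolP (j \in s).
  by move=> /(_ measurableT A mA); rewrite setTI.
Qed.

End Independence.

Section ProductExpectation.
Context {R : realType} {d : measure_display} {Omega : measurableType d}.
Variable P : probability Omega R.

Lemma independent2_comp d1 (E1 : measurableType d1) d2 (E2 : measurableType d2)
   d3 (F1 : measurableType d3) d4 (F2 : measurableType d4)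
   (U : Omega -> E1) (V : Omega -> E2) (f : E1 -> F1) (g : E2 -> F2) :
  measurable_fun setT f -> measurable_fun setT g ->
  independent2 P U V -> independent2 P (f \o U) (g \o V).
Proof.
move=> mf mg ind A B mA mB.
apply: (ind (f @^-1` A) (g @^-1` B)).
- by rewrite -[X in measurable X]setTI; exact: mf.
- by rewrite -[X in measurable X]setTI; exact: mg.
Qed.

(** Independence says that the joint law and the product of the laws agree on
    rectangles. *)
Lemma independent2_law (U V : {mfun Omega >-> R}) : independent2 P U V ->
  forall C : set (R * R), measurable C ->
  (distribution P U \x distribution P V)%E C =
  P ((fun w => (U w, V w)) @^-1` C).
Proof.
move=> ind C mC.
have mUV : measurable_fun setT (fun w => (U w, V w)).
  by apply: measurable_fun_pair; exact: measurable_funP.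
pose UV : {mfun Omega >-> (R * R)%type} := mfun_Sub (mem_set mUV).
rewrite (@product_measure_unique _ _ _ _ _ _ _ (distribution P UV))//.
Qed.

(** Fubini's theorem for the product law, first with absolute values for the
    integrability and then without. *)
Lemma mfun_expectM (U V : {mfun Omega >-> R}) : independent2 P U V ->
  P.-integrable setT (EFin \o U) -> P.-integrable setT (EFin \o V) ->
  P.-integrable setT (EFin \o (U \* V)) /\
  \int[P]_w (U w * V w) = \int[P]_w U w * \int[P]_w V w.
Proof.
move=> ind iU iV.
have mUV : measurable_fun setT (fun w => (U w, V w)).
  by apply: measurable_fun_pair; exact: measurable_funP.
pose UV : {mfun Omega >-> (R * R)%type} := mfun_Sub (mem_set mUV).
pose mU := distribution P U; pose mV := distribution P V.
have law C : measurable C -> distribution P UV C = (mU \x mV)%E C.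
  by move=> mC; rewrite /mU /mV independent2_law.
have mid : measurable_fun [set: R] (@EFin R) by exact: EFin_measurable.
have iu : mU.-integrable [set: R] (@EFin R).
  by apply: integrable_pushforward => //; rewrite preimage_setT.
have iv : mV.-integrable [set: R] (@EFin R).
  by apply: integrable_pushforward => //; rewrite preimage_setT.
pose h (z : R * R) : \bar R := (z.1 * z.2)%:E.
have mh : measurable_fun [set: R * R] h.
  by apply/measurable_EFinP; apply: measurable_funM.
have ih : (mU \x mV)%E.-integrable [set: R * R] h.
  apply/integrable12ltyP => //.
  under eq_integral => u _.
    under eq_integral => v _ do rewrite /h /= normrM EFinM.
    rewrite ge0_integralZl//; last first.
      by apply/measurable_EFinP; exact: normr_measurable.
    over.
  rewrite /= ge0_integralZr//; last 2 first.
    by apply/measurable_EFinP; exact: normr_measurable.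
    by apply: integral_ge0.
  apply: lte_mul_pinfty.
  - by apply: integral_ge0.
  - by rewrite ge0_fin_numE ?integral_ge0//; case/integrableP : iu.
  - by case/integrableP : iv.
have hUV : P.-integrable setT (h \o UV).
  apply/integrableP; split; first exact: measurableT_comp.
  rewrite [ltLHS](_ : _ = \int[distribution P UV]_z (abse \o h) z)%E; last first.
    apply/esym/ge0_integral_distribution; last by move=> z; exact: abse_ge0.
    exact: (measurableT_comp (@abse_measurable R setT) mh).
  rewrite (eq_measure_integral (mU \x mV)%E); last first.
    by move=> C mC _; exact: law.
  by case/integrableP : ih.
split; first by [].
rewrite /Rintegral.
have -> : (\int[P]_w (U w * V w)%:E = \int[distribution P UV]_z h z)%E.
  by rewrite integral_distribution.
have -> : (\int[distribution P UV]_z h z = \int[mU \x mV]_z h z)%E.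
  by apply: eq_measure_integral => C mC _; exact: law.
rewrite -(@integral12_prod_meas1 _ _ _ _ _ mU mV)//.
rewrite (@eq_integral _ R R mU setT (fun u : R => u%:E * \int[mV]_v v%:E)%E); last first.
  move=> u _; rewrite /fubini_F -integralZl//.
rewrite -(fineK (integrable_fin_num measurableT iv)) integralZr//.
rewrite fineM//; last exact: integrable_fin_num.
by rewrite /= !integral_distribution.
Qed.

Lemma independent2_expectM (U V : Omega -> R) :
  measurable_fun setT U -> measurable_fun setT V -> independent2 P U V ->
  P.-integrable setT (EFin \o U) -> P.-integrable setT (EFin \o V) ->
  P.-integrable setT (EFin \o (U \* V)) /\
  \int[P]_w (U w * V w) = \int[P]_w U w * \int[P]_w V w.
Proof.
move=> mU mV.
exact: (@mfun_expectM (mfun_Sub (mem_set mU)) (mfun_Sub (mem_set mV))).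
Qed.

End ProductExpectation.

(** * Moments and a Marcinkiewicz-Zygmund inequality *)

Section Moments.
Context {R : realType} {d : measure_display} {Omega : measurableType d}.
Variable P : probability Omega R.
Implicit Types (f g U V W : Omega -> R) (q K : R).

Lemma integrable_dominated f g :
  measurable_fun setT f -> (forall w, `|f w| <= g w) ->
  P.-integrable setT (EFin \o g) -> P.-integrable setT (EFin \o f).
Proof.
move=> mf fg; apply: le_integrable => //; first exact/measurable_EFinP.
by move=> w _ /=; rewrite lee_fin (le_trans (fg w))// ler_norm.
Qed.

Lemma integrable_add f g : P.-integrable setT (EFin \o f) ->
  P.-integrable setT (EFin \o g) -> P.-integrable setT (EFin \o (fun w => f w + g w)).
Proof. by move=> hf hg; have := integrableD measurableT hf hg. Qed.

Lemma integrable_scale k f : P.-integrable setT (EFin \o f) ->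
  P.-integrable setT (EFin \o (fun w => k * f w)).
Proof. by move=> hf; have := integrableZl measurableT k hf. Qed.

Lemma integrable_const k : P.-integrable setT (EFin \o (fun=> k : R)).
Proof. exact: finite_measure_integrable_cst. Qed.

Lemma Rintegral_const k : \int[P]_w k = k.
Proof.
rewrite /Rintegral integral_cst// -[RHS]mulr1 -[RHS]/(fine (k%:E * 1%:E)).
by congr (fine (_ * _)); exact: probability_setT.
Qed.

Lemma measurable_powR_norm q f : measurable_fun setT f ->
  measurable_fun setT (fun w => `|f w| `^ q).
Proof.
move=> mf; apply: (@measurableT_comp _ _ _ _ _ _ (@powR R ^~ q)) => //.
exact: measurableT_comp.
Qed.

(** On a probability space a lower power is at most [1] plus a higher one; this
    crude form of Lyapunov's inequality costs only a constant. *)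
Lemma integrable_powR_le f a b : 0 <= a <= b -> measurable_fun setT f ->
  P.-integrable setT (EFin \o (fun w => `|f w| `^ b)) ->
  P.-integrable setT (EFin \o (fun w => `|f w| `^ a)) /\
  \int[P]_w `|f w| `^ a <= 1 + \int[P]_w `|f w| `^ b.
Proof.
move=> ab mf ib.
have i1b := integrable_add (integrable_const 1) ib.
have ia : P.-integrable setT (EFin \o (fun w => `|f w| `^ a)).
  apply: (integrable_dominated _ _ i1b); first exact: measurable_powR_norm.
  by move=> w /=; rewrite ger0_norm ?powR_ge0//; exact: powR_le1D.
split => //.
rewrite -[X in X + _]Rintegral_const -RintegralD//; last exact: integrable_const.
by apply: le_Rintegral => // w _; exact: powR_le1D.
Qed.

End Moments.

Section MarcinkiewiczZygmund.
Context {R : realType} {d : measure_display} {Omega : measurableType d}.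
Variable P : probability Omega R.

(** With the scale of [mz_arith], the terms of one step that do not involve the
    previous moment add up to at most one half of this constant times
    [n ^ (q / 2 - 1)]; [1 + K] bounds the second moments. *)
Definition mz_const (q K : R) : R :=
  let C := taylor_const q in let L := 1 + K in
  2 * (C * L * (2 * C * L) `^ (q / 2 - 1) + C * K).

(** With [n.+1 = m], the growth [m ^ (q / 2) = m * m ^ (q / 2 - 1)] leaves room for
    a whole unit of [m ^ (q / 2 - 1)]: one half is spent on the factor
    [1 + (2 m)^-1] in front of [A], the other half on the remaining terms. *)
Lemma mz_arith (q K : R) (n : nat) (A : R) : 2 <= q -> 0 <= K ->
  let C := taylor_const q in let L := 1 + K in
  let t2 := 2 * C * L * n.+1%:R in
  A <= mz_const q K * n%:R `^ (q / 2) ->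
  A + C * (t2 `^ (q / 2 - 1) * L + A * L / t2 + K) <= mz_const q K * n.+1%:R `^ (q / 2).
Proof.
move=> q2 K0 C L t2 hA.
have C1 : 1 <= C by exact: taylor_const_ge1.
have L1 : 1 <= L by rewrite /L; lra.
set B := mz_const q K in hA *.
pose X := (2 * C * L) `^ (q / 2 - 1).
have X0 : 0 <= X by exact: powR_ge0.
have BE : B = 2 * (C * L * X + C * K) by [].
have m1 : 1 <= n.+1%:R :> R by rewrite ler1n.
set m : R := n.+1%:R in t2 m1 *.
have nm : n%:R = m - 1 by rewrite /m -natr1; ring.
pose p := m `^ (q / 2 - 1).
have p1 : 1 <= p.
  rewrite -(powRr0 m); apply: ler_powR => //; lra.
have mp : m `^ (q / 2) = m * p by rewrite mulr_powRB1//; lra.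
have np : n%:R `^ (q / 2) <= n%:R * p.
  rewrite -(@mulr_powRB1 _ n%:R (q / 2))//; last by lra.
  rewrite ler_wpM2l//; apply: ge0_ler_powR; rewrite ?nnegrE//; lra.
have tE : t2 `^ (q / 2 - 1) = X * p by rewrite /t2 powRM//; nra.
have CL1 : 1 <= C * L by nra.
have B0 : 0 <= B by rewrite BE; nra.
have hA' : A <= B * ((m - 1) * p).
  by apply: (le_trans hA); rewrite ler_wpM2l// -nm.
have e : C * (A * L / t2) = A / (2 * m).
  by rewrite /t2; field; rewrite !gt_eqF//; lra.
have -> : A + C * (t2 `^ (q / 2 - 1) * L + A * L / t2 + K) =
   A * (1 + (2 * m)^-1) + C * L * X * p + C * K.
  rewrite tE [C * _]mulrDr [C * (X * p * L + A * L / t2)]mulrDr e; ring.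
have h1 : A * (1 + (2 * m)^-1) <= B * ((m - 1) * p) * (1 + (2 * m)^-1).
  by rewrite ler_wpM2r// addr_ge0// invr_ge0; lra.
have h2 : C * L * X * p + C * K <= B * p / 2.
  rewrite BE; have : C * K <= C * K * p by rewrite ler_peMr// mulr_ge0//; lra.
  by lra.
have h3 : (m - 1) * (1 + (2 * m)^-1) + 1 / 2 <= m.
  have -> : (m - 1) * (1 + (2 * m)^-1) = m - 1 + 1 / 2 - (2 * m)^-1.
    by field; rewrite gt_eqF//; lra.
  have i0 : 0 <= (2 * m)^-1 by rewrite invr_ge0; lra.
  by move: ((2 * m)^-1) i0 => z z0; clear -z0; lra.
have h4 := ler_wpM2l (mulr_ge0 B0 (le_trans ler01 p1)) h3.
rewrite mp; move: ((2 * m)^-1) h1 h4 => z h1 h4; clear -h1 h2 h4; lra.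
Qed.

(** The sum is built one term at a time.  In [powR_taylor] at [S + W i] the linear
    term has expectation zero, because [W i] is centered and independent of [S].
    The quadratic term is split by [powR_split] at [t ^ 2] proportional to the
    number of summands, and its expectation factors.  The resulting recursion for
    the moments is solved by [mz_arith]. *)
Theorem marcinkiewicz_zygmund (q K : R) (I : finType) (W : I -> Omega -> R) :
  2 <= q ->
  (forall i, measurable_fun setT (W i)) ->
  mutually_independent P W ->
  (forall i, P.-integrable setT (EFin \o (fun w => `|W i w| `^ q))) ->
  (forall i, \int[P]_w `|W i w| `^ q <= K) ->
  (forall i, \int[P]_w W i w = 0) ->
  forall s : seq I, uniq s ->
  let S w := \sum_(j <- s) W j w in
  P.-integrable setT (EFin \o (fun w => `|S w| `^ q)) /\
  \int[P]_w `|S w| `^ q <= mz_const q K * (size s)%:R `^ (q / 2).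
Proof.
move=> q2.
have C1 := taylor_const_ge1 q2.
have q0 : 0 < q by lra.
have q1 : 0 < q - 1 by lra.
have q01 : 0 <= (1 : R) <= q by lra.
have q02 : 0 <= (2 : R) <= q by lra.
have qq1 : 0 <= q - 1 <= q by lra.
have q2E : q - 2 = (q - 1) - 1 by ring.
move=> mW indW iW WK W0; elim=> [_ /=|i s IH /= /andP[is_ us]].
  have e w : `|\sum_(j <- [::]) W j w| `^ q = 0.
    by rewrite big_nil normr0 powR0// gt_eqF.
  under eq_fun do rewrite e.
  split; first exact: integrable_const.
  by rewrite Rintegral_const mulr0n powR0 ?mulr0// gt_eqF// divr_gt0.
have [iS hS] := IH us; move: iS hS.
pose S w := \sum_(j <- s) W j w; rewrite -/(S _) => iS hS.
have SE w : \sum_(j <- i :: s) W j w = S w + W i w by rewrite big_cons addrC.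
under eq_fun do rewrite SE.
have mS : measurable_fun setT S by exact: measurable_sum.
have indS : independent2 P S (W i) by exact: independent2_sum.
have K0 : 0 <= K by apply: le_trans (WK i); apply: Rintegral_ge0 => w _; exact: powR_ge0.
have [iW1 _] := @integrable_powR_le _ _ _ P (W i) 1 q q01 (mW i) (iW i).
have [iW2 hW2] := @integrable_powR_le _ _ _ P (W i) 2 q q02 (mW i) (iW i).
have [iS1 _] := @integrable_powR_le _ _ _ P S (q - 1) q qq1 mS iS.
have iWi : P.-integrable setT (EFin \o W i).
  by apply: integrable_dominated iW1 => // w; rewrite powRr1.
have iSW : P.-integrable setT (EFin \o (fun w => `|S w + W i w| `^ q)).
  have iD := integrable_scale (2 `^ q) (integrable_add iS (iW i)).
  apply: (integrable_dominated _ _ iD).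
    by apply: measurable_powR_norm; exact: measurable_funD.
  by move=> w; rewrite ger0_norm ?powR_ge0//; apply: powR_normD_le; exact: ltW.
split => //.
pose phi (a : R) := a * `|a| `^ (q - 2).
have mphi : measurable_fun [set: R] phi.
  by apply: measurable_funM => //; exact: measurable_powR_norm.
have mpow b : measurable_fun [set: R] (fun a : R => `|a| `^ b).
  exact: measurable_powR_norm.
have iphi : P.-integrable setT (EFin \o (phi \o S)).
  apply: (integrable_dominated _ _ iS1); first exact: measurableT_comp.
  move=> w /=; rewrite /phi normrM (ger0_norm (powR_ge0 _ _)).
  by rewrite q2E mulr_powRB1.
have [iPW] := independent2_expectM (measurableT_comp mphi mS) (mW i)
  (independent2_comp mphi (@measurable_id _ _ setT) indS) iphi iWi.
rewrite W0 mulr0 => ePW.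
have [iSS] := independent2_expectM (measurable_powR_norm q mS)
  (measurable_powR_norm 2 (mW i)) (independent2_comp (mpow q) (mpow 2) indS) iS iW2.
move=> eSS.
set C := taylor_const q in C1.
pose L := 1 + K.
have L1 : 1 <= L by rewrite /L lerDl.
(* With this scale the term [`|S| `^ q * `|W i| `^ 2 / t2] multiplies the moment
   of [S] by at most [1 + (2 n)^-1], where [n] is the new number of summands. *)
pose t2 := 2 * C * L * (size s).+1%:R.
have t20 : 0 < t2.
  by rewrite /t2 !mulr_gt0// ?(lt_le_trans ltr01 C1) ?(lt_le_trans ltr01 L1).
pose t := Num.sqrt t2.
have t0 : 0 < t by rewrite sqrtr_gt0.
have tt : t ^+ 2 = t2 by rewrite sqr_sqrtr// ltW.
have tq : t `^ (q - 2) = t2 `^ (q / 2 - 1).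
  rewrite -tt -(powR_mulrn _ (ltW t0)) -powRrM; congr (_ `^ _).
  by rewrite mulrBr mulr1 mulrCA divff// mulr1.
set x := t2 `^ (q / 2 - 1) in tq.
have x0 : 0 <= x by exact: powR_ge0.
apply: le_trans (mz_arith q2 K0 hS); rewrite -/C -/L -/t2 -/x.
set A := \int[P]_w `|S w| `^ q in hS *.
have A0 : 0 <= A by apply: Rintegral_ge0 => w _; exact: powR_ge0.
have iG1 := integrable_add (integrable_scale x iW2) (integrable_scale t2^-1 iSS).
have iG2 := integrable_scale C (integrable_add iG1 (iW i)).
have iG3 := integrable_add iS (integrable_scale q iPW).
have iG := integrable_add iG3 iG2.
apply: (@le_trans _ _ (\int[P]_w (`|S w| `^ q + q * (phi (S w) * W i w) +
   C * (x * `|W i w| `^ 2 + t2^-1 * (`|S w| `^ q * `|W i w| `^ 2) + `|W i w| `^ q)))).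
  apply: le_Rintegral => // w _; apply: (le_trans (powR_taylor (S w) (W i w) q2)).
  rewrite lerD2l ler_wpM2l//; first exact: le_trans ler01 C1.
  rewrite lerD2r -real_normK ?num_real// -powR_mulrn// mulrA -mulrDl.
  rewrite ler_wpM2r ?powR_ge0//.
  by apply: (le_trans (powR_split (S w) q2 t0)); rewrite tq tt [_^-1 * _]mulrC.
rewrite RintegralD// RintegralD//; last exact: integrable_scale.
rewrite RintegralZl// [X in q * X]ePW mulr0 addr0 lerD2l.
rewrite RintegralZl//; last exact: integrable_add.
rewrite RintegralD// RintegralD//; last 2 first.
  exact: integrable_scale.
  exact: integrable_scale.
rewrite RintegralZl// RintegralZl// [X in t2^-1 * X]eSS -/A.
rewrite ler_wpM2l//; first exact: le_trans ler01 C1.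
have hW2' : \int[P]_w `|W i w| `^ 2 <= L.
  by apply: (le_trans hW2); rewrite /L lerD2l.
rewrite lerD// lerD//; first by rewrite ler_wpM2l.
by rewrite mulrC ler_wpM2r ?invr_ge0 ?(ltW t20)// ler_wpM2l.
Qed.

End MarcinkiewiczZygmund.

(** * Quadratic forms and the restricted eigenvalue *)

Section QuadraticForms.
Context {R : realType}.

(** The Cauchy-Schwarz inequality against the constant vector. *)
Lemma sqr_sum_le (I : finType) (A : {set I}) (a : I -> R) :
  (\sum_(i in A) a i) ^+ 2 <= #|A|%:R * \sum_(i in A) a i ^+ 2.
Proof.
rewrite expr2 big_distrlr /=.
apply: (@le_trans _ _ (\sum_(i in A) \sum_(j in A) (a i ^+ 2 / 2 + a j ^+ 2 / 2))).
  apply: ler_sum => i _; apply: ler_sum => j _.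
  by have := sqr_ge0 (a i - a j); rewrite sqrrB; lra.
under [leLHS]eq_bigr do rewrite big_split/=.
rewrite big_split/= [X in _ + X]exchange_big/= -big_split/=.
rewrite mulr_sumr; apply: ler_sum => i _.
rewrite sumr_const -mulr_natl; lra.
Qed.

Definition quad n (M : 'M[R]_n) (v : 'cV[R]_n) : R := (v^T *m M *m v) ord0 ord0.

Definition l1 n (v : 'cV[R]_n) : R := \sum_(j < n) `|v j ord0|.

Lemma quad_perturb n (M M' : 'M[R]_n) (e : R) (v : 'cV[R]_n) :
  (forall i j, `|M i j - M' i j| <= e) ->
  quad M v <= quad M' v + e * l1 v ^+ 2.
Proof.
move=> h; rewrite -lerBlDl.
have -> : quad M v - quad M' v = quad (M - M') v.
  by rewrite /quad mulmxBr mulmxBl !mxE.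
rewrite /quad -mulmxA mxE.
have -> : l1 v ^+ 2 = \sum_i \sum_j `|v i ord0| * `|v j ord0|.
  by rewrite expr2 /l1 big_distrlr.
rewrite mulr_sumr; apply: ler_sum => i _.
rewrite !mxE mulr_sumr mulr_sumr; apply: ler_sum => j _.
apply: (le_trans (ler_norm _)); rewrite !normrM !mxE.
have := h i j; rewrite mulrCA => hij.
by rewrite ler_wpM2r.
Qed.

Lemma norm2_sqr n (v : 'cV[R]_n) : norm2 v ^+ 2 = \sum_(j < n) v j ord0 ^+ 2.
Proof. by rewrite sqr_sqrtr// sumr_ge0// => j _; exact: sqr_ge0. Qed.

Lemma norm2_sqr_gt0 n (v : 'cV[R]_n) : v != 0 -> 0 < norm2 v ^+ 2.
Proof.
move=> v0; rewrite norm2_sqr lt0r sumr_ge0 ?andbT; last first.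
  by move=> j _; exact: sqr_ge0.
apply: contraNneq v0 => /eqP; rewrite psumr_eq0; last first.
  by move=> j _; exact: sqr_ge0.
move=> /allP h; apply/eqP/matrixP => i j; rewrite (ord1 j) mxE.
by have := h i (mem_index_enum _); rewrite sqrf_eq0 => /eqP.
Qed.

Lemma l1_sqr_le n (v : 'cV[R]_n) : l1 v ^+ 2 <= n%:R * norm2 v ^+ 2.
Proof.
rewrite norm2_sqr /l1.
have := sqr_sum_le [set: 'I_n]%SET (fun j => `|v j ord0|).
rewrite cardsT card_ord.
under eq_bigl do rewrite inE.
under [in X in _ <= X]eq_bigl do rewrite inE.
by under [in X in _ <= X]eq_bigr do rewrite real_normK ?num_real//.
Qed.

Lemma norm1_setC n (A : {set 'I_n}) (v : 'cV[R]_n) :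
  norm1 A v + norm1 (~: A)%SET v = l1 v.
Proof.
rewrite /l1 /norm1 [RHS](bigID (mem A))/=; congr (_ + _).
by apply: eq_bigl => j; rewrite !inE.
Qed.

Lemma norm1_sqr_le n (A : {set 'I_n}) (v : 'cV[R]_n) :
  norm1 A v ^+ 2 <= #|A|%:R * norm2 v ^+ 2.
Proof.
apply: (le_trans (sqr_sum_le _ _)); rewrite ler_wpM2l// norm2_sqr.
under eq_bigr do rewrite real_normK ?num_real//.
rewrite [leRHS](bigID (mem A))/= lerDl sumr_ge0// => j _; exact: sqr_ge0.
Qed.

Lemma l1_split m n (v : 'cV[R]_(m + n)) : l1 v = l1 (usubmx v) + l1 (dsubmx v).
Proof.
rewrite /l1 big_split_ord/=; congr (_ + _);
  by apply: eq_bigr => i _; rewrite mxE.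
Qed.

Lemma norm2_split m n (v : 'cV[R]_(m + n)) :
  norm2 v ^+ 2 = norm2 (usubmx v) ^+ 2 + norm2 (dsubmx v) ^+ 2.
Proof.
rewrite !norm2_sqr big_split_ord/=; congr (_ + _);
  by apply: eq_bigr => i _; rewrite mxE.
Qed.

Lemma norm1_ge0 n (A : {set 'I_n}) (v : 'cV[R]_n) : 0 <= norm1 A v.
Proof. exact: sumr_ge0. Qed.

(** The cross term [2 A B] is handled by the arithmetic-geometric mean inequality
    for [r * b] and [s * a]. *)
Lemma cauchy_two_blocks (A B a b r s : R) : 0 <= A -> 0 <= B -> 0 <= a -> 0 <= b ->
  0 <= r -> 0 <= s -> A ^+ 2 <= r * a -> B ^+ 2 <= s * b ->
  (A + B) ^+ 2 <= (r + s) * (a + b).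
Proof.
move=> A0 B0 a0 b0 r0 s0 hA hB.
suff : 2 * (A * B) <= r * b + s * a by rewrite sqrrD; nra.
rewrite -(@ler_pXn2r _ 2) ?nnegrE ?mulr_ge0 ?addr_ge0 ?mulr_ge0//.
have h1 : (A * B) ^+ 2 <= (r * b) * (s * a).
  rewrite exprMn; have -> : r * b * (s * a) = (r * a) * (s * b) by ring.
  by apply: ler_pM => //; exact: sqr_ge0.
have := sqr_ge0 (r * b - s * a); nra.
Qed.

End QuadraticForms.

Section RestrictedEigenvalueBounds.
Context {R : realType}.
Variables (N T p s1 s2 : nat) (lambda mu : R).
Hypotheses (N0 : (0 < N)%N) (T0 : (0 < T)%N) (lambda0 : 0 < lambda) (mu0 : 0 < mu).

Local Notation cone := (restricted_cone T s1 s2 lambda mu).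
Local Notation kappa2 := (@kappa2 R N T p s1 s2 lambda mu).

Lemma mNT_gt0 : 0 < mNT N lambda mu.
Proof.
by rewrite lt_max divr_gt0// mulr_gt0// sqrtr_gt0 ltr0n.
Qed.

(** With the weights [al] and [be] of the two blocks, the cone condition bounds the
    weighted l1-norm by four times its part on [R1] and [R2].  Dividing by the
    smaller weight costs the ratio of the weights, which is [mNT], and the
    Cauchy-Schwarz inequality on at most [s1 + s2] coordinates gives the l2-norm. *)
Lemma cone_l1_le (v : 'cV[R]_(p + N)) R1 R2 : cone v R1 R2 ->
  l1 v ^+ 2 <= 16 * (s1 + s2)%:R * mNT N lambda mu ^+ 2 * norm2 v ^+ 2.
Proof.
move=> [cR1 cR2].
set m := mNT N lambda mu.
have sT : 0 < Num.sqrt T%:R :> R by rewrite sqrtr_gt0 ltr0n.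
have sN : 0 < Num.sqrt N%:R :> R by rewrite sqrtr_gt0 ltr0n.
set al := lambda / _; set be := mu / _.
have al0 : 0 < al by rewrite divr_gt0// sqrtr_gt0 ltr0n muln_gt0 N0.
have be0 : 0 < be by rewrite divr_gt0.
have sE : Num.sqrt (N * T)%:R = Num.sqrt N%:R * Num.sqrt T%:R :> R.
  by rewrite natrM sqrtrM.
have m1 : al <= m * be.
  rewrite -ler_pdivrMr// /m /mNT le_max; apply/orP; left.
  rewrite le_eqVlt; apply/orP; left; apply/eqP.
  by rewrite /al /be sE; field; rewrite !gt_eqF.
have m2 : be <= m * al.
  rewrite -ler_pdivrMr// /m /mNT le_max; apply/orP; right.
  rewrite le_eqVlt; apply/orP; left; apply/eqP.
  by rewrite /al /be sE; field; rewrite !gt_eqF.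
have m0 : 0 < m := mNT_gt0.
set A := norm1 R1 _; set B := norm1 R2 _.
set A' := norm1 (~: R1)%SET _; set B' := norm1 (~: R2)%SET _ => hc.
have A0 : 0 <= A := norm1_ge0 _ _.
have B0 : 0 <= B := norm1_ge0 _ _.
have A'0 : 0 <= A' := norm1_ge0 _ _.
have B'0 : 0 <= B' := norm1_ge0 _ _.
have l1E : l1 v = A + A' + (B + B') by rewrite l1_split -(norm1_setC R1) -(norm1_setC R2).
have h : l1 v <= 4 * m * (A + B).
  have [ab|/ltW ba] := leP al be.
    rewrite -(ler_pM2l al0) l1E.
    have h1 : al * (B + B') <= be * (B + B') by rewrite ler_wpM2r// addr_ge0.
    have h2 : al * A <= be * A by rewrite ler_wpM2r.
    have h3 : be * (A + B) <= m * al * (A + B) by rewrite ler_wpM2r// addr_ge0.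
    lra.
  rewrite -(ler_pM2l be0) l1E.
  have h1 : be * (A + A') <= al * (A + A') by rewrite ler_wpM2r// addr_ge0.
  have h2 : be * B <= al * B by rewrite ler_wpM2r.
  have h3 : al * (A + B) <= m * be * (A + B) by rewrite ler_wpM2r// addr_ge0.
  lra.
have hAB : (A + B) ^+ 2 <= (s1%:R + s2%:R) * norm2 v ^+ 2.
  rewrite norm2_split; apply: cauchy_two_blocks; rewrite ?sqr_ge0 ?ler0n//.
  - by apply: (le_trans (norm1_sqr_le _ _)); rewrite ler_wpM2r ?sqr_ge0// ler_nat.
  - by apply: (le_trans (norm1_sqr_le _ _)); rewrite ler_wpM2r ?sqr_ge0// ler_nat.
have l0 : 0 <= l1 v by rewrite l1E !addr_ge0.
have h2 : l1 v ^+ 2 <= (4 * m * (A + B)) ^+ 2.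
  by rewrite ler_pXn2r ?nnegrE// !mulr_ge0 ?addr_ge0// ltW.
apply: (le_trans h2); rewrite exprMn exprMn natrD.
have := ler_wpM2l (sqr_ge0 m) hAB; lra.
Qed.

(** The set of quotients of which [kappa2] is the infimum. *)
Definition rayleigh (M : 'M[R]_(p + N)) : set R :=
  [set q | exists delta R1 R2, [/\ delta != 0, cone delta R1 R2 &
     q = quad M delta / norm2 delta ^+ 2]].

Lemma kappa2E M : kappa2 M = inf (rayleigh M). Proof. by []. Qed.

Lemma kappa2_has_lbound (M : 'M[R]_(p + N)) : has_lbound (rayleigh M).
Proof.
pose e := \sum_(ij : 'I_(p + N) * 'I_(p + N)) `|M ij.1 ij.2|.
exists (- (e * (p + N)%:R)) => _ [v [R1 [R2 [v0 _ ->]]]].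
have n0 := norm2_sqr_gt0 v0.
rewrite ler_pdivlMr// mulNr -subr_ge0 opprK.
have h : quad 0 v <= quad M v + e * l1 v ^+ 2.
  apply: quad_perturb => i j; rewrite mxE sub0r normrN.
  by rewrite /e (bigD1 (i, j))//= lerDl sumr_ge0.
move: h; rewrite {1}/quad mulmx0 mul0mx mxE => h.
apply: (le_trans h); rewrite lerD2l -mulrA ler_wpM2l//; first exact: sumr_ge0.
exact: l1_sqr_le.
Qed.

(** The set of admissible vectors does not depend on the matrix, so a uniform
    comparison of the quotients passes to the infimum; if there is no admissible
    vector, both infima are [0]. *)
Lemma kappa2_perturb (M M' : 'M[R]_(p + N)) (c : R) : 0 <= c ->
  (forall v R1 R2, v != 0 -> cone v R1 R2 ->
     quad M v <= quad M' v + c * norm2 v ^+ 2) ->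
  kappa2 M <= kappa2 M' + c.
Proof.
move=> c0 h; rewrite !kappa2E.
have [Q0|/set0P Q0] := eqVneq (rayleigh M') set0.
  suff -> : rayleigh M = set0 by rewrite Q0 inf0 add0r.
  rewrite -subset0 => q [v [R1 [R2 [v0 cv _]]]].
  have : rayleigh M' (quad M' v / norm2 v ^+ 2) by exists v, R1, R2; split.
  by rewrite Q0.
rewrite -lerBlDr; apply: lb_le_inf => // _ [v [R1 [R2 [v0 cv ->]]]].
rewrite lerBlDr.
apply: (@le_trans _ _ (quad M v / norm2 v ^+ 2)).
  apply: ge_inf; first exact: kappa2_has_lbound.
  by exists v, R1, R2; split.
have n0 := norm2_sqr_gt0 v0.
by rewrite ler_pdivrMr// mulrDl divfK ?gt_eqF//; exact: h cv.
Qed.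

Lemma kappa2_lipschitz (M M' : 'M[R]_(p + N)) (e : R) : 0 <= e ->
  (forall i j, `|M i j - M' i j| <= e) ->
  kappa2 M <= kappa2 M' + (p + N)%:R * e.
Proof.
move=> e0 h; apply: kappa2_perturb; first exact: mulr_ge0.
move=> v R1 R2 _ _; apply: (le_trans (quad_perturb v h)).
rewrite lerD2l [(p + N)%:R * e]mulrC -mulrA ler_wpM2l//; exact: l1_sqr_le.
Qed.

Lemma kappa2_cone_perturb (M M' : 'M[R]_(p + N)) (e : R) : 0 <= e ->
  (forall i j, `|M i j - M' i j| <= e) ->
  kappa2 M <= kappa2 M' + e * (16 * (s1 + s2)%:R * mNT N lambda mu ^+ 2).
Proof.
move=> e0 h; apply: kappa2_perturb.
  by rewrite !mulr_ge0// ltW// mNT_gt0.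
move=> v R1 R2 _ cv; apply: (le_trans (quad_perturb v h)).
by rewrite lerD2l -[leRHS]mulrA ler_wpM2l//; exact: cone_l1_le cv.
Qed.

(** A vector of the cone then has l1-norm zero by [cone_l1_le], so the infimum is
    taken over the empty set. *)
Lemma kappa2_eq0 (M : 'M[R]_(p + N)) : (s1 + s2 = 0)%N -> kappa2 M = 0.
Proof.
move=> s0; rewrite kappa2E (_ : rayleigh M = set0) ?inf0//.
rewrite -subset0 => q [v [R1 [R2 [v0 cv _]]]].
have := cone_l1_le cv; rewrite s0 mulr0 !mul0r => h.
have n0 := norm2_sqr_gt0 v0.
suff h' : norm2 v ^+ 2 <= l1 v ^+ 2.
  by move: (lt_le_trans n0 (le_trans h' h)); rewrite ltxx.
have l0 j : `|v j ord0| <= l1 v.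
  by rewrite /l1 (bigD1 j)//= lerDl sumr_ge0.
rewrite norm2_sqr expr2 {1}/l1 mulr_suml; apply: ler_sum => j _.
by rewrite -real_normK ?num_real// expr2 ler_wpM2l.
Qed.

(** A coordinate vector whose index lies in [R1] or [R2] belongs to the cone,
    because the left-hand side of the cone condition vanishes. *)
Lemma kappa2_le_diag (M : 'M[R]_(p + N)) (c : R) : (0 < s1 + s2)%N ->
  (0 < p)%N ->
  (forall i, M i i <= c) -> kappa2 M <= c.
Proof.
move=> s0 p0 Mc.
have key (j : 'I_(p + N)) (R1 : {set 'I_p}) (R2 : {set 'I_N}) :
    (#|R1| <= s1)%N -> (#|R2| <= s2)%N ->
    (forall k, k \notin R1 -> lshift N k != j) ->
    (forall k, k \notin R2 -> rshift p k != j) -> kappa2 M <= c.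
  move=> c1 c2 h1 h2.
  pose v : 'cV[R]_(p + N) := delta_mx j ord0.
  have v0 : v != 0.
    apply/eqP => /matrixP/(_ j ord0); rewrite !mxE !eqxx /= => /eqP.
    by rewrite oner_eq0.
  apply: (le_trans _ (Mc j)); apply: ge_inf; first exact: kappa2_has_lbound.
  exists v, R1, R2; split => //.
    split => //.
    have -> : norm1 (~: R1)%SET (usubmx v) = 0.
      rewrite /norm1 big1// => k; rewrite inE => /h1 kj.
      by rewrite !mxE (negbTE kj) normr0.
    have -> : norm1 (~: R2)%SET (dsubmx v) = 0.
      rewrite /norm1 big1// => k; rewrite inE => /h2 kj.
      by rewrite !mxE (negbTE kj) normr0.
    by rewrite !mulr0 addr0 addr_ge0// !mulr_ge0 ?norm1_ge0 ?invr_ge0 ?sqrtr_ge0// ltW.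
  have -> : norm2 v ^+ 2 = 1.
    rewrite norm2_sqr (bigD1 j)//= big1 ?addr0.
      by rewrite !mxE !eqxx expr1n.
    by move=> k kj; rewrite mxE (negbTE kj) expr0n.
  by rewrite divr1 /quad trmx_delta -rowE -colE !mxE.
(* [s1] and [s2] are not both zero: a coordinate of the first block is allowed if
   [s1 > 0], one of the second block otherwise. *)
have [s10|s10] := ltnP 0 s1.
  apply: (key (lshift N (Ordinal p0)) [set Ordinal p0]%SET finset.set0).
  - by rewrite cards1.
  - by rewrite cards0.
  - by move=> k; rewrite inE (inj_eq (@lshift_inj _ _)).
  - by move=> k _; rewrite eq_sym eq_lrshift.
apply: (key (rshift p (Ordinal N0)) finset.set0 [set Ordinal N0]%SET).
- by rewrite cards0.
- by rewrite cards1; move: s10 s0; rewrite leqn0 => /eqP ->.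
- by move=> k _; rewrite eq_lrshift.
- by move=> k; rewrite inE (inj_eq (@rshift_inj _ _)).
Qed.

End RestrictedEigenvalueBounds.

(** * Measurability of the restricted eigenvalue *)

Section Measurability.
Context {R : realType} {d : measure_display} {Omega : measurableType d}.

Lemma measurable_set_le (f : Omega -> R) (c : R) : measurable_fun setT f ->
  measurable [set w | f w <= c].
Proof.
move=> mf; rewrite -[X in measurable X]setTI.
have -> : [set w | f w <= c] = f @^-1` `]-oo, c].
  by apply/seteqP; split=> w /=; rewrite in_itv.
exact: mf.
Qed.

Lemma measurable_set_gt (f : Omega -> R) (c : R) : measurable_fun setT f ->
  measurable [set w | c < f w].
Proof.
move=> mf; have := measurableC (measurable_set_le c mf); congr (measurable _).
by apply/seteqP; split=> w /=; rewrite ltNge => /negP.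
Qed.

(** The sublevel set [F (G w) < c] is the union, over rational points [Q] and
    precisions [1 / n.+1] with [F Q + L / n.+1 < c], of the events that [G w] is
    within [1 / n.+1] of [Q]; this union is countable. *)
Lemma measurable_lipschitz_ge (I : finType) (F : {ffun I -> R} -> R) (L : R)
    (G : Omega -> {ffun I -> R}) (c : R) :
  0 <= L ->
  (forall (f g : {ffun I -> R}) e, 0 <= e -> (forall i, `|f i - g i| <= e) ->
     F f <= F g + L * e) ->
  (forall i, measurable_fun setT (fun w => G w i)) ->
  measurable [set w | c <= F (G w)].
Proof.
move=> L0 lip mG.
pose real_of (Q : {ffun I -> rat}) : {ffun I -> R} := [ffun i => ratr (Q i)].
pose B (k : {ffun I -> rat} * nat) : set Omega :=
  if F (real_of k.1) + L * k.2.+1%:R^-1 < c then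
    \bigcap_(i in [set: I]) [set w | `|G w i - real_of k.1 i| <= k.2.+1%:R^-1]
  else set0.
have mB k : measurable (B k).
  rewrite /B; case: ifP => // _; apply: fin_bigcap_measurable => // i _.
  apply: measurable_set_le; apply: measurableT_comp => //.
  exact: measurable_funB.
have -> : [set w | c <= F (G w)] = ~` (\bigcup_k B k).
  apply/seteqP; split=> w /=.
    move=> cF [k _]; rewrite /B; case: ifPn => // kc wB.
    have := lip (G w) (real_of k.1) _ (ltW _) (fun i => wB i Logic.I).
    rewrite invr_gt0 ltr0Sn => /(_ isT) h.
    by move: (lt_le_trans kc (le_trans cF h)); rewrite ltxx.
  move=> nB; rewrite leNgt; apply/negP => Fc; apply: nB.
  have [n hn] : exists n, 2 * L / n.+1%:R < c - F (G w).
    have d0 : 0 < c - F (G w) by rewrite subr_gt0.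
    exists (Num.truncn (2 * L / (c - F (G w)))).
    rewrite ltr_pdivrMr ?ltr0Sn// [ltRHS]mulrC -ltr_pdivrMr//.
    exact: truncnS_gt.
  have n0 : 0 < n.+1%:R^-1 :> R by rewrite invr_gt0 ltr0Sn.
  have [Q hQ] : exists Q : I -> rat, forall i, `|G w i - ratr (Q i)| <= n.+1%:R^-1.
    have H i : exists q : rat, `|G w i - ratr q| <= n.+1%:R^-1.
      have /rat_in_itvoo[q] : G w i - n.+1%:R^-1 < G w i by rewrite ltrBlDr ltrDl.
      rewrite in_itv/= => /andP[h1 h2]; exists q.
      by rewrite ger0_norm ?subr_ge0 ?(ltW h2)// lerBlDr addrC -lerBlDr ltW.
    by have [Q hQ] := choice H; exists Q.
  exists (finfun Q, n) => //.
  have hG i : `|G w i - real_of (finfun Q) i| <= n.+1%:R^-1.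
    by rewrite !ffunE.
  rewrite /B ifT /=; first by move=> i _; exact: hG.
  have : F (real_of (finfun Q)) <= F (G w) + L * n.+1%:R^-1.
    by apply: lip => [|i]; [exact: ltW | rewrite distrC].
  by move: hn; move: (n.+1%:R^-1) => z; lra.
apply: measurableC; exact: countable_bigcupT_measurable.
Qed.

Lemma measurable_kappa2_ge (N T p s1 s2 : nat) (lambda mu : R)
   (M : Omega -> 'M[R]_(p + N)) (c : R) :
  (forall i j, measurable_fun setT (fun w => M w i j)) ->
  measurable [set w | c <= kappa2 T s1 s2 lambda mu (M w)].
Proof.
move=> mM.
pose mx (f : {ffun 'I_(p + N) * 'I_(p + N) -> R}) : 'M[R]_(p + N) :=
  \matrix_(i, j) f (i, j).
pose G w := [ffun ij => M w ij.1 ij.2].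
have -> : [set w | c <= kappa2 T s1 s2 lambda mu (M w)] =
          [set w | c <= (kappa2 T s1 s2 lambda mu \o mx) (G w)].
  apply/seteqP; split=> w /=; rewrite (_ : mx (G w) = M w)//;
    by apply/matrixP => i j; rewrite !mxE ffunE.
apply: (@measurable_lipschitz_ge _ _ (p + N)%:R) => //.
  move=> f g e e0 h; apply: kappa2_lipschitz => // i j; rewrite !mxE; exact: h.
by move=> i; under eq_fun do rewrite ffunE; exact: mM.
Qed.

End Measurability.

(** * Entries of the Gram matrix *)

Section GramMatrix.
Context {R : realType} {d : measure_display} {Omega : measurableType d}.
Variable P : probability Omega R.
Variables (N T p : nat).
Hypotheses (N0 : (0 < N)%N) (T0 : (0 < T)%N).
Variable x : 'I_N -> 'I_T -> 'I_p -> {RV P >-> R}.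

(** The rows of the design matrix are indexed by pairs (individual, date) encoded
    in ['I_(N * T)]. *)
Lemma sum_mxtens (F : 'I_N -> 'I_T -> R) :
  \sum_(h < N * T) F (mxtens_unindex h).1 (mxtens_unindex h).2 =
  \sum_i \sum_t F i t.
Proof.
rewrite pair_bigA/= (reindex (@mxtens_unindex N T))//=.
by exists (fun ij => mxtens_index ij) => ij _; rewrite (mxtens_indexK, mxtens_unindexK).
Qed.

Let a : R := Num.sqrt (N * T)%:R.
Let b : R := Num.sqrt T%:R.
Let a0 : a != 0.
Proof. by rewrite gt_eqF// sqrtr_gt0 ltr0n muln_gt0 N0. Qed.
Let b0 : b != 0.
Proof. by rewrite gt_eqF// sqrtr_gt0 ltr0n. Qed.

Lemma invmx_Smx : invmx (Smx N T p) = block_mx (a^-1)%:M 0 0 (b^-1)%:M :> 'M[R]_(p + N).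
Proof.
set Si := block_mx _ _ _ _.
have SiS : Si *m Smx N T p = 1%:M.
  rewrite /Si /Smx mulmx_block !mul0mx !mulmx0 !addr0 !add0r -!scalar_mxM.
  by rewrite !mulVf// -scalar_mx_block.
have [uSi uS] := mulmx1_unit SiS.
by rewrite -[RHS]mulmx1 -(mulmxV uS) mulmxA SiS mul1mx.
Qed.

Lemma Psi_block w : Psi x w =
  block_mx (a^-1 *: ((a^-1 *: (Xmx x w)^T) *m Xmx x w))
           (b^-1 *: ((a^-1 *: (Xmx x w)^T) *m Dmx N T))
           (a^-1 *: ((b^-1 *: (Dmx N T)^T) *m Xmx x w))
           (b^-1 *: ((b^-1 *: (Dmx N T)^T) *m Dmx N T)).
Proof.
rewrite /Psi invmx_Smx /Zmx tr_row_mx mul_block_col !mul0mx addr0 add0r.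
rewrite !mul_scalar_mx mul_col_row mulmx_block !mulmx0 !addr0 !add0r.
by rewrite !mul_mx_scalar.
Qed.

Lemma DmxE h i : Dmx N T h i = ((mxtens_unindex h).1 == i)%:R :> R.
Proof.
rewrite /Dmx castmxE /= !mxE mulr1 cast_ord_id.
congr (_ == _)%:R; apply: val_inj => /=; by rewrite divn1.
Qed.

Lemma XmxTX w k l : ((Xmx x w)^T *m Xmx x w) k l = \sum_i \sum_t x i t k w * x i t l w.
Proof.
rewrite mxE -(sum_mxtens (fun i t => x i t k w * x i t l w)).
by apply: eq_bigr => h _; rewrite !mxE.
Qed.

Lemma XmxTD w k i : ((Xmx x w)^T *m Dmx N T) k i = \sum_t x i t k w.
Proof.
rewrite mxE.
rewrite (eq_bigr (fun h => x (mxtens_unindex h).1 (mxtens_unindex h).2 k w *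
   ((mxtens_unindex h).1 == i)%:R)); last by move=> h _; rewrite DmxE !mxE.
rewrite (sum_mxtens (fun j t => x j t k w * (j == i)%:R)).
rewrite (bigD1 i)//= [X in _ + X]big1 ?addr0.
  by apply: eq_bigr => t _; rewrite eqxx mulr1.
by move=> j /negbTE ji; apply: big1 => t _; rewrite ji mulr0.
Qed.

Lemma DmxTD i j : ((Dmx N T)^T *m Dmx N T) i j = T%:R * (i == j)%:R :> R.
Proof.
rewrite mxE (eq_bigr (fun h => ((mxtens_unindex h).1 == i)%:R *
   ((mxtens_unindex h).1 == j)%:R)); last by move=> h _; rewrite mxE !DmxE.
rewrite (sum_mxtens (fun i' t => (i' == i)%:R * (i' == j)%:R)).
rewrite (bigD1 i)//= [X in _ + X]big1 ?addr0.
  by rewrite eqxx mul1r sumr_const card_ord mulr_natl.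
by move=> j' /negbTE ji; apply: big1 => t _; rewrite ji mul0r.
Qed.

Lemma Psi_XX w k l : Psi x w (lshift N k) (lshift N l) =
  (N * T)%:R^-1 * \sum_i \sum_t x i t k w * x i t l w.
Proof.
rewrite Psi_block block_mxEul mxE -scalemxAl mxE XmxTX mulrA; congr (_ * _).
by rewrite -invfM -expr2 sqr_sqrtr.
Qed.

Lemma Psi_XD w k i : Psi x w (lshift N k) (rshift p i) =
  (Num.sqrt N%:R)^-1 * (T%:R^-1 * \sum_t x i t k w).
Proof.
rewrite Psi_block block_mxEur mxE -scalemxAl mxE XmxTD !mulrA; congr (_ * _).
rewrite -!invfM; congr (_^-1).
by rewrite /a natrM sqrtrM// mulrCA -expr2 sqr_sqrtr.
Qed.

Lemma Psi_DX w k i :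
  Psi x w (rshift p i) (lshift N k) = Psi x w (lshift N k) (rshift p i).
Proof.
rewrite Psi_block block_mxEur block_mxEdl -!scalemxAl.
rewrite mxE [X in _ * X = _]mxE [RHS]mxE [X in _ = _ * X]mxE mulrCA.
congr (_ * (_ * _)); have -> : (Dmx N T)^T *m Xmx x w = ((Xmx x w)^T *m Dmx N T)^T.
  by rewrite trmx_mul trmxK.
by rewrite mxE.
Qed.

Lemma Psi_DD w i j : Psi x w (rshift p i) (rshift p j) = (i == j)%:R.
Proof.
rewrite Psi_block block_mxEdr mxE -scalemxAl mxE DmxTD !mulrA.
have -> : b^-1 * b^-1 = T%:R^-1 by rewrite -invfM -expr2 sqr_sqrtr.
by rewrite mulVf ?mul1r// pnatr_eq0 -lt0n.
Qed.

Lemma Gamma_XX k l : Gamma x (lshift N k) (lshift N l) =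
  \int[P]_w (Psi x w (lshift N k) (lshift N l)).
Proof.
rewrite /Gamma block_mxEul mxE unlock /Rintegral; congr fine.
by apply: eq_integral => w _; rewrite Psi_XX XmxTX mulrC.
Qed.

Lemma Gamma_XD k i : Gamma x (lshift N k) (rshift p i) = 0.
Proof. by rewrite /Gamma block_mxEur mxE. Qed.

Lemma Gamma_DX k i : Gamma x (rshift p i) (lshift N k) = 0.
Proof. by rewrite /Gamma block_mxEdl mxE. Qed.

Lemma Gamma_DD i j : Gamma x (rshift p i) (rshift p j) = (i == j)%:R.
Proof. by rewrite /Gamma block_mxEdr mxE. Qed.

Lemma measurable_Psi i j : measurable_fun setT (fun w => Psi x w i j).
Proof.
case: (split_ordP i) => k ->; case: (split_ordP j) => l ->.
- under eq_fun do rewrite Psi_XX.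
  apply: measurable_funM => //; apply: measurable_sum => i'.
  by apply: measurable_sum => t; apply: measurable_funM.
- under eq_fun do rewrite Psi_XD.
  by do 2 (apply: measurable_funM => //); apply: measurable_sum => t.
- under eq_fun do rewrite Psi_DX Psi_XD.
  by do 2 (apply: measurable_funM => //); apply: measurable_sum => t.
- by under eq_fun do rewrite Psi_DD; exact: measurable_cst.
Qed.

End GramMatrix.

(** * Averages, tail bounds and equality of laws *)

(** Jensen's inequality for a uniform average: Young's inequality bounds
    [`|z t| * m `^ (q - 1)], with [m] the average of the [`|z t|], and averaging
    over [t] gives [m `^ q] on the left. *)
Lemma powR_mean_le {R : realType} (T : nat) (q : R) (z : 'I_T -> R) :
  (0 < T)%N -> 1 < q ->
  `|T%:R^-1 * \sum_t z t| `^ q <= T%:R^-1 * \sum_t `|z t| `^ q.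
Proof.
move=> T0 q1.
have iT0 : 0 < T%:R^-1 :> R by rewrite invr_gt0 ltr0n.
pose m := T%:R^-1 * \sum_t `|z t|.
have m0 : 0 <= m by rewrite mulr_ge0 ?(ltW iT0)// sumr_ge0.
apply: (@le_trans _ _ (m `^ q)).
  apply: ge0_ler_powR; rewrite ?nnegrE//; first by lra.
  by rewrite normrM (gtr0_norm iT0) ler_wpM2l ?(ltW iT0)// ler_norm_sum.
pose q' := q / (q - 1).
have q'0 : 0 < q' by rewrite divr_gt0; lra.
have qq' : q^-1 + q'^-1 = 1.
  by rewrite /q'; field; rewrite !gt_eqF//; lra.
have mE : m * m `^ (q - 1) = m `^ q by rewrite mulr_powRB1//; lra.
have mE' : (m `^ (q - 1)) `^ q' = m `^ q.
  rewrite -powRrM; congr (_ `^ _); rewrite /q'; field; rewrite gt_eqF//; lra.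
have h : m `^ q <= (T%:R^-1 * \sum_t `|z t| `^ q) / q + m `^ q / q'.
  rewrite -{1}mE /m -mulrA mulr_suml.
  have -> : m `^ q / q' = T%:R^-1 * \sum_(t < T) (m `^ q / q').
    rewrite sumr_const card_ord -[X in _ = _ * X]mulr_natl mulrA mulVf ?mul1r//.
    by rewrite pnatr_eq0 -lt0n.
  rewrite -[X in _ <= X + _]mulrA -mulrDr ler_wpM2l ?(ltW iT0)//.
  rewrite mulr_suml -big_split/=; apply: ler_sum => t _; rewrite -/m -mE'.
  by apply: conjugate_powR; rewrite ?powR_ge0//; lra.
have h2 : m `^ q / q <= (T%:R^-1 * \sum_t `|z t| `^ q) / q.
  by have : m `^ q = m `^ q / q + m `^ q / q' by [rewrite -mulrDr qq' mulr1]; lra.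
by move: h2; rewrite ler_pM2r// invr_gt0; lra.
Qed.

Section MomentBounds.
Context {R : realType} {d : measure_display} {Omega : measurableType d}.
Variable P : probability Omega R.

Lemma Rintegral_sum (I : Type) (s : seq I) (f : I -> Omega -> R) :
  (forall i, P.-integrable setT (EFin \o f i)) ->
  P.-integrable setT (EFin \o (fun w => \sum_(i <- s) f i w)) /\
  \int[P]_w (\sum_(i <- s) f i w) = \sum_(i <- s) \int[P]_w f i w.
Proof.
move=> fi; elim: s => [|i s [IHi IHs]].
  rewrite big_nil; under eq_fun do rewrite big_nil.
  by split; [exact: integrable_const|exact: Rintegral_const].
rewrite big_cons; under eq_fun do rewrite big_cons.
split; first exact: integrable_add.
by rewrite RintegralD// IHs.
Qed.

Lemma moment_mean_le (T : nat) (q K : R) (z : 'I_T -> Omega -> R) :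
  (0 < T)%N -> 1 < q ->
  (forall t, measurable_fun setT (z t)) ->
  (forall t, P.-integrable setT (EFin \o (fun w => `|z t w| `^ q))) ->
  (forall t, \int[P]_w `|z t w| `^ q <= K) ->
  let Z w := T%:R^-1 * \sum_t z t w in
  P.-integrable setT (EFin \o (fun w => `|Z w| `^ q)) /\
  \int[P]_w `|Z w| `^ q <= K.
Proof.
move=> T0 q1 mz iz zK Z.
have [isum esum] := Rintegral_sum (index_enum 'I_T) iz.
have iT0 : 0 < T%:R^-1 :> R by rewrite invr_gt0 ltr0n.
have imean := integrable_scale T%:R^-1 isum.
have mZ : measurable_fun setT (fun w => `|Z w| `^ q).
  apply: measurable_powR_norm; apply: measurable_funM => //.
  exact: measurable_sum.
have iZ : P.-integrable setT (EFin \o (fun w => `|Z w| `^ q)).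
  apply: (integrable_dominated mZ _ imean) => w.
  by rewrite ger0_norm ?powR_ge0//; exact: powR_mean_le.
split => //.
apply: (@le_trans _ _ (\int[P]_w (T%:R^-1 * \sum_t `|z t w| `^ q))).
  by apply: le_Rintegral => // w _; exact: powR_mean_le.
rewrite RintegralZl// esum ler_pdivrMl ?ltr0n//.
apply: (le_trans (ler_sum _ (fun t _ => zK t))).
by rewrite sumr_const card_ord mulr_natl.
Qed.

Lemma markov_moment (f : Omega -> R) (q c K : R) : 0 < q -> 0 < c ->
  measurable_fun setT f ->
  P.-integrable setT (EFin \o (fun w => `|f w| `^ q)) ->
  \int[P]_w `|f w| `^ q <= K ->
  (P [set w | (c < `|f w|)%R] <= (K / c `^ q)%:E)%E.
Proof.
move=> q0 c0 mf fi fK.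
pose X : {RV P >-> R} := mfun_Sub (mem_set mf).
have mnf : measurable_fun setT (fun w => `|f w|) by exact: measurableT_comp.
have cq0 : 0 < c `^ q by rewrite powR_gt0.
have := @markov _ _ _ P X (fun r => r `^ q) c c0 (@measurable_powR R q)
  (fun r _ => powR_ge0 r q) (ge0_ler_powR (ltW q0)).
rewrite unlock => h.
have h2 : ((c `^ q)%:E * P [set w | (c%:E <= `|(X w)%:E|)%E] <= K%:E)%E.
  apply: (le_trans h); rewrite -lee_fin in fK; apply: le_trans fK.
  by rewrite /Rintegral fineK//; exact: integrable_fin_num.
rewrite EFinM lee_pdivlMr// muleC; apply: le_trans h2; rewrite lee_wpmul2l//.
  by rewrite lee_fin ltW.
have e : [set w | (c%:E <= `|(X w)%:E|)%E] = [set w | c <= `|f w|].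
  by apply/seteqP; split=> w /=; rewrite lee_fin.
rewrite e le_measure ?inE//.
- exact: measurable_set_gt.
- have -> : [set w | c <= `|f w|] = [set w | - `|f w| <= - c].
    by apply/seteqP; split=> w /=; rewrite lerN2.
  by apply: measurable_set_le; exact: measurable_funN.
- by move=> w /= /ltW.
Qed.

Lemma union_bound (I : finType) (A : I -> set Omega) (c : R) :
  (forall i, measurable (A i)) -> (forall i, (P (A i) <= c%:E)%E) ->
  (P (\bigcup_(i in [set: I]) A i) <= (#|I|%:R * c)%R%:E)%E.
Proof.
move=> mA hA.
have key (s : seq I) : (P (\big[setU/set0]_(i <- s) A i) <= ((size s)%:R * c)%R%:E)%E.
  elim: s => [|i s IH]; first by rewrite big_nil measure0 mul0r.
  rewrite big_cons /= -natr1 mulrDl mul1r addrC EFinD.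
  have mB : measurable (\big[setU/set0]_(j <- s) A j) by exact: bigsetU_measurable.
  exact: (le_trans (measureU2 P (mA i) mB) (leeD (hA i) IH)).
have := key (enum I); rewrite -cardT -bigcup_seq (_ : [set` enum I] = [set: I])//.
by apply/seteqP; split=> i //= _; rewrite mem_enum.
Qed.

Lemma identically_distributed_moment d1 (E : measurableType d1) (I : Type)
    (Y : I -> Omega -> E) (g : E -> R) (i j : I) :
  (forall i, measurable_fun setT (Y i)) ->
  measurable_fun setT g -> (forall z, 0 <= g z) ->
  identically_distributed P Y ->
  (\int[P]_w (g (Y i w))%:E = \int[P]_w (g (Y j w))%:E)%E.
Proof.
move=> mY mg g0 idY.
pose X k : {RV P >-> E} := mfun_Sub (mem_set (mY k)).
have h k : (\int[distribution P (X k)]_z (g z)%:E = \int[P]_w (g (Y k w))%:E)%E.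
  by rewrite ge0_integral_distribution//; exact/measurable_EFinP.
rewrite -!h; apply: eq_measure_integral => B mB _; exact: idY.
Qed.

End MomentBounds.

(** * Deviations of the entries of the Gram matrix *)

Section ProductMoments.
Context {R : realType} {d : measure_display} {Omega : measurableType d}.
Variable P : probability Omega R.

(** Arithmetic-geometric mean inequality for the squares of [`|u| `^ q] and
    [`|v| `^ q]. *)
Lemma moment_product_le (q : R) (u v : Omega -> R) : 0 <= q ->
  measurable_fun setT u -> measurable_fun setT v ->
  P.-integrable setT (EFin \o (fun w => `|u w| `^ (2 * q))) ->
  P.-integrable setT (EFin \o (fun w => `|v w| `^ (2 * q))) ->
  \int[P]_w `|u w| `^ (2 * q) <= 1 -> \int[P]_w `|v w| `^ (2 * q) <= 1 ->
  P.-integrable setT (EFin \o (fun w => `|u w * v w| `^ q)) /\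
  \int[P]_w `|u w * v w| `^ q <= 1.
Proof.
have sq (y z : R) : y * z <= 2^-1 * (y ^+ 2 + z ^+ 2).
  by have := sqr_ge0 (y - z); rewrite sqrrB; lra.
move=> q0 mu mv iu iv hu hv.
have amgm w : `|u w * v w| `^ q <= 2^-1 * (`|u w| `^ (2 * q) + `|v w| `^ (2 * q)).
  rewrite normrM powRM//.
  have e (z : R) : `|z| `^ (2 * q) = (`|z| `^ q) ^+ 2.
    by rewrite mulrC powRrM powR_mulrn ?powR_ge0.
  by rewrite !e; exact: sq.
have iD := integrable_add iu iv.
have i2 := integrable_scale 2^-1 iD.
have muv : measurable_fun setT (fun w => `|u w * v w| `^ q).
  by apply: measurable_powR_norm; exact: measurable_funM.
have iuv : P.-integrable setT (EFin \o (fun w => `|u w * v w| `^ q)).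
  apply: (integrable_dominated muv _ i2) => w.
  by rewrite ger0_norm ?powR_ge0.
split; first exact: iuv.
apply: (@le_trans _ _ (\int[P]_w (2^-1 * (`|u w| `^ (2 * q) + `|v w| `^ (2 * q))))).
  by apply: le_Rintegral => // w _; exact: amgm.
rewrite RintegralZl// RintegralD//.
by rewrite mulrC ler_pdivrMr// mul1r; exact: lerD hu hv.
Qed.

(** The inner [2] bounds the absolute value of the mean. *)
Definition centering_const (q : R) : R := 2 `^ q * (1 + 2 `^ q).

(** Subtracting the mean is handled by [powR_normD_le], the mean itself being at
    most one plus the moment of order [q]. *)
Lemma centered_moment_le (q : R) (f : Omega -> R) : 1 <= q ->
  measurable_fun setT f ->
  P.-integrable setT (EFin \o (fun w => `|f w| `^ q)) ->
  \int[P]_w `|f w| `^ q <= 1 ->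
  let g w := f w - \int[P]_w f w in
  [/\ P.-integrable setT (EFin \o f),
      P.-integrable setT (EFin \o (fun w => `|g w| `^ q)),
      \int[P]_w `|g w| `^ q <= centering_const q &
      P.-integrable setT (EFin \o g) /\ \int[P]_w g w = 0].
Proof.
move=> q1.
have q01 : 0 <= (1 : R) <= q by rewrite ler01.
have q0 : 0 <= q by lra.
move=> mf ifq hf g.
have [if1 hf1] := @integrable_powR_le _ _ _ P f 1 q q01 mf ifq.
have fi : P.-integrable setT (EFin \o f).
  by apply: (integrable_dominated mf _ if1) => w; rewrite powRr1.
set m := \int[P]_w f w in g *.
have m2 : `|m| <= 2.
  apply: (le_trans (@le_normr_Rintegral _ _ _ P setT f measurableT fi)).
  rewrite (@eq_Rintegral _ _ _ P setT (fun w => `|f w| `^ 1)); last first.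
    by move=> w _; rewrite powRr1.
  by apply: (le_trans hf1); rewrite -[2]/(1 + 1) lerD2l.
have gi : P.-integrable setT (EFin \o g).
  exact: (integrable_add fi (integrable_const P (- m))).
have mg : measurable_fun setT (fun w => `|g w| `^ q).
  by apply: measurable_powR_norm; exact: measurable_funB.
have ib := integrable_scale (2 `^ q) (integrable_add ifq (integrable_const P (2 `^ q))).
have hb w : `|g w| `^ q <= 2 `^ q * (`|f w| `^ q + 2 `^ q).
  apply: (le_trans (powR_normD_le (f w) (- m) q0)); rewrite normrN.
  rewrite ler_wpM2l ?powR_ge0// lerD2l.
  by apply: ge0_ler_powR; rewrite ?nnegrE.
have igq : P.-integrable setT (EFin \o (fun w => `|g w| `^ q)).
  by apply: (integrable_dominated mg _ ib) => w; rewrite ger0_norm ?powR_ge0.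
split => //.
- apply: (@le_trans _ _ (\int[P]_w (2 `^ q * (`|f w| `^ q + 2 `^ q)))).
    by apply: le_Rintegral => // w _; exact: hb.
  rewrite RintegralZl//; last exact: (integrable_add ifq (integrable_const P _)).
  rewrite RintegralD//; last exact: integrable_const.
  by rewrite Rintegral_const ler_wpM2l ?powR_ge0// lerD2r.
- split => //; rewrite RintegralB//; last exact: integrable_const.
  by rewrite Rintegral_const subrr.
Qed.

End ProductMoments.

Section PanelTails.
Context {R : realType} {d : measure_display} {Omega : measurableType d}.
Variable P : probability Omega R.
Variables (N T p : nat).
Hypotheses (N0 : (0 < N)%N) (T0 : (0 < T)%N).
Variable x : 'I_N -> 'I_T -> 'I_p -> {RV P >-> R}.
Variable eps : 'I_N -> 'I_T -> {RV P >-> R}.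
Variables (i1 : 'I_N) (r : R).
Hypotheses (hA1 : assumption_A1 x eps) (hA2 : assumption_A2a x eps i1 r).

Let E : measurableType _ := (T.-tuple (p.-tuple R) * T.-tuple R)%type.
Let Y (i : 'I_N) (w : Omega) : E := (x_elt x i w, eps_elt eps i w).

Lemma measurable_panel i : measurable_fun setT (Y i).
Proof.
apply: measurable_fun_pair.
  apply/measurable_fun_tnthP => t; apply/measurable_fun_tnthP => k.
  rewrite (_ : _ \o _ = x i t k)//.
  by apply/funext => w /=; rewrite !tnth_mktuple.
apply/measurable_fun_tnthP => t; rewrite (_ : _ \o _ = eps i t)//.
by apply/funext => w /=; rewrite tnth_mktuple.
Qed.

Definition panel_coord t k (z : E) : R := tnth (tnth z.1 t) k.

Lemma panel_coordE i t k w : panel_coord t k (Y i w) = x i t k w.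
Proof. by rewrite /panel_coord /Y /= !tnth_mktuple. Qed.

Lemma measurable_panel_coord t k : measurable_fun setT (panel_coord t k).
Proof.
apply: (measurableT_comp (measurable_tnth k)).
exact: (measurableT_comp (measurable_tnth t) measurable_fst).
Qed.

(** The moment condition concerns the first individual; it holds for all of them
    because they have the same law. *)
Lemma covariate_moment i t k :
  P.-integrable setT (EFin \o (fun w => `|x i t k w| `^ r)) /\
  \int[P]_w `|x i t k w| `^ r <= 1.
Proof.
case: hA1 => -[_ idY] _ _; case: hA2 => _ _ /(_ k) hmax.
have mpow : measurable_fun setT (fun z => `|panel_coord t k z| `^ r).
  by apply: measurable_powR_norm; exact: measurable_panel_coord.
have e1 : (\int[P]_w (`|x i1 t k w| `^ r)%:E <= 1)%E.
  apply: le_trans hmax.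
  have := le_bigmax 0%E (fun t => 'E_P[fun w => (`|x i1 t k w| `^ r)%R])%E t.
  have -> : ('E_P[fun w => (`|x i1 t k w| `^ r)%R] =
      \int[P]_w (`|x i1 t k w| `^ r)%:E)%E by rewrite unlock.
  by [].
have e2 : (\int[P]_w (`|x i t k w| `^ r)%:E <= 1)%E.
  apply: le_trans e1; rewrite le_eqVlt; apply/orP; left; apply/eqP.
  have := @identically_distributed_moment _ _ _ P _ E _ Y
    (fun z => `|panel_coord t k z| `^ r) i i1 measurable_panel mpow
    (fun z => powR_ge0 _ _) idY.
  under eq_integral do rewrite panel_coordE.
  by under [X in _ = X -> _]eq_integral do rewrite panel_coordE.
have ige0 : (0 <= \int[P]_w (`|x i t k w| `^ r)%:E)%E.
  by apply: integral_ge0 => w _; rewrite lee_fin powR_ge0.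
have fin : P.-integrable setT (EFin \o (fun w => `|x i t k w| `^ r)).
  apply/integrableP; split.
    by apply/measurable_EFinP; exact: measurable_powR_norm.
  under eq_integral do rewrite /= ger0_norm ?powR_ge0//.
  exact: (le_lt_trans e2 (ltry _)).
split => //.
by rewrite -lee_fin /Rintegral fineK//; exact: integrable_fin_num.
Qed.

Lemma cross_moment (hr : 2 <= r) i t k l :
  let f w := x i t k w * x i t l w in
  P.-integrable setT (EFin \o (fun w => `|f w| `^ (r / 2))) /\
  \int[P]_w `|f w| `^ (r / 2) <= 1.
Proof.
have rE : 2 * (r / 2) = r by field.
have q0 : 0 <= r / 2 by lra.
have [ik hk] := covariate_moment i t k; have [il hl] := covariate_moment i t l.
have := @moment_product_le _ _ _ P (r / 2) (x i t k) (x i t l) q0.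
rewrite rE => h.
exact: (h (measurable_funP _) (measurable_funP _) ik il hk hl).
Qed.

Lemma Gamma_XXE (hr : 2 <= r) k l : Gamma x (lshift N k) (lshift N l) =
  (N * T)%:R^-1 * \sum_i \sum_t \int[P]_w (x i t k w * x i t l w).
Proof.
have ix i t : P.-integrable setT (EFin \o (fun w => x i t k w * x i t l w)).
  have [i1q h1q] := cross_moment hr i t k l.
  have q1 : 1 <= r / 2 by lra.
  have mf : measurable_fun setT (fun w => x i t k w * x i t l w).
    exact: measurable_funM.
  by case: (centered_moment_le q1 mf i1q h1q).
have isum i := Rintegral_sum (index_enum 'I_T) (ix i).
have [iss ess] := Rintegral_sum (index_enum 'I_N) (fun i => (isum i).1).
rewrite Gamma_XX//; under eq_Rintegral do rewrite Psi_XX//.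
by rewrite RintegralZl// ess; congr (_ * _); apply: eq_bigr => i _; case: (isum i).
Qed.

(** On the block of the covariates the entry is an average of second moments, each
    at most one plus the moment of order [r]. *)
Lemma Gamma_diag_le2 (hr : 2 <= r) j : Gamma x j j <= 2.
Proof.
case: (split_ordP j) => k ->; last by rewrite Gamma_DD eqxx ler1n.
rewrite Gamma_XXE// ler_pdivrMl ?ltr0n ?muln_gt0 ?N0//.
have h i t : \int[P]_w (x i t k w * x i t k w) <= 2.
  have [ir hr1] := covariate_moment i t k.
  have [i2 h2] := @integrable_powR_le _ _ _ P (x i t k) 2 r ltac:(lra)
    (measurable_funP (x i t k)) ir.
  rewrite (@eq_Rintegral _ _ _ P setT (fun w => `|x i t k w| `^ 2)); last first.
    by move=> w _; rewrite powR_mulrn// real_normK ?num_real.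
  by lra.
apply: (@le_trans _ _ (\sum_(i < N) \sum_(t < T) (2 : R))).
  by apply: ler_sum => i _; apply: ler_sum => t _.
by rewrite !sumr_const !card_ord -mulrnA mulnC -[X in X <= _]mulr_natl.
Qed.

(** The first summand serves the block of the covariates, the second one the
    off-diagonal blocks. *)
Definition tail_const : R := mz_const (r / 2) (centering_const (r / 2)) + 2.

Lemma scaled_tail (f : Omega -> R) (q K c s : R) : 2 <= q -> 0 < c -> 0 < s ->
  measurable_fun setT f ->
  P.-integrable setT (EFin \o (fun w => `|f w| `^ q)) ->
  \int[P]_w `|f w| `^ q <= K ->
  (P [set w | (c < `|s^-1 * f w|)%R] <= (K / (s `^ q * c `^ q))%:E)%E.
Proof.
move=> q2 c0 s0 mf fi fK.
rewrite -powRM ?(ltW s0) ?(ltW c0)//.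
have -> : [set w | c < `|s^-1 * f w|] = [set w | s * c < `|f w|].
  apply/seteqP; split=> w /=; rewrite normrM normfV (gtr0_norm s0);
    by rewrite ltr_pdivlMl.
apply: markov_moment => //; [lra|exact: mulr_gt0].
Qed.

Lemma mz_const_ge0 (q K : R) : 2 <= q -> 0 <= K -> 0 <= mz_const q K.
Proof.
move=> q2 K0; have C1 := taylor_const_ge1 q2; rewrite /mz_const.
have X0 := powR_ge0 (2 * taylor_const q * (1 + K)) (q / 2 - 1).
have CK : 0 <= taylor_const q * K by rewrite mulr_ge0//; lra.
rewrite mulr_ge0// addr_ge0// mulr_ge0// mulr_ge0//; lra.
Qed.

Lemma centering_const_ge0 (q : R) : 0 <= centering_const q.
Proof. by rewrite mulr_ge0 ?addr_ge0 ?powR_ge0. Qed.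

(** The deviation is the average over [i] of independent centered variables, the
    averages over [t] of the centered products.  The moment of order [r / 2] of
    their sum is of order [N ^ (r / 4)], against [(N c) ^ (r / 2)] in Markov's
    inequality. *)
Lemma tail_XX (hr : 4 <= r) (c : R) k l : 0 < c ->
  (P [set w | (c < `|Psi x w (lshift N k) (lshift N l) -
                    Gamma x (lshift N k) (lshift N l)|)%R] <=
   (tail_const / (N%:R `^ (r / 4) * c `^ (r / 2)))%:E)%E.
Proof.
move=> c0; have q2 : 2 <= r / 2 by lra.
have q1 : 1 <= r / 2 by lra.
have r2 : 2 <= r by lra.
have N0' : 0 < N%:R :> R by rewrite ltr0n.
pose f i t w := x i t k w * x i t l w.
pose e i t := \int[P]_w f i t w.
have mf i t : measurable_fun setT (f i t) by exact: measurable_funM.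
pose g i t w := f i t w - e i t.
have cm i t := centered_moment_le q1 (mf i t) (cross_moment r2 i t k l).1
  (cross_moment r2 i t k l).2.
have mg i t : measurable_fun setT (g i t) by exact: measurable_funB.
pose W i w := T%:R^-1 * \sum_t g i t w.
have [iW hW] : (forall i, P.-integrable setT (EFin \o (fun w => `|W i w| `^ (r / 2)))) /\
    (forall i, \int[P]_w `|W i w| `^ (r / 2) <= centering_const (r / 2)).
  have h i : P.-integrable setT (EFin \o (fun w => `|W i w| `^ (r / 2))) /\
    \int[P]_w `|W i w| `^ (r / 2) <= centering_const (r / 2).
    apply: moment_mean_le => //; first by lra.
    - by move=> t; case: (cm i t).
    - by move=> t; case: (cm i t).
  by split=> i; case: (h i).
have W0 i : \int[P]_w W i w = 0.
  have ig t : P.-integrable setT (EFin \o g i t) by case: (cm i t) => _ _ _ [].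
  have [isum esum] := Rintegral_sum (index_enum 'I_T) ig.
  rewrite RintegralZl// esum big1 ?mulr0// => t _.
  by case: (cm i t) => _ _ _ [].
have mW i : measurable_fun setT (W i).
  by apply: measurable_funM => //; exact: measurable_sum.
have indW : mutually_independent P W.
  case: hA1 => -[indY _] _ _.
  pose h i (z : E) := T%:R^-1 * \sum_t (panel_coord t k z * panel_coord t l z - e i t).
  have -> : W = (fun i => h i \o Y i).
    apply/funext => i; apply/funext => w; rewrite /W /h /=; congr (_ * _).
    by apply: eq_bigr => t _; rewrite !panel_coordE.
  apply: mutually_independent_comp indY => i.
  apply: measurable_funM => //; apply: measurable_sum => t.
  by apply: measurable_funB => //; apply: measurable_funM; exact: measurable_panel_coord.
have := marcinkiewicz_zygmund q2 mW indW iW hW W0 (enum_uniq 'I_N).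
rewrite -cardT card_ord.
set S := fun w => _; move=> [iS hS].
have mS : measurable_fun setT S by exact: measurable_sum.
have e0 w : Psi x w (lshift N k) (lshift N l) - Gamma x (lshift N k) (lshift N l) =
    N%:R^-1 * S w.
  rewrite Psi_XX// Gamma_XXE// -mulrBr -sumrB natrM invfM -mulrA; congr (_ * _).
  rewrite /S /W -mulr_sumr big_enum/=; congr (_ * _).
  by apply: eq_bigr => i _; rewrite -sumrB.
rewrite (_ : [set w | _] = [set w | c < `|N%:R^-1 * S w|]); last first.
  by apply/seteqP; split=> w /=; rewrite e0.
apply: (le_trans (scaled_tail q2 c0 N0' mS iS hS)); rewrite lee_fin.
have e4 : N%:R `^ (r / 2) = N%:R `^ (r / 4) * N%:R `^ (r / 4) :> R.
  rewrite -powRD; last by rewrite (gt_eqF N0') implybT.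
  by congr (_ `^ _); field.
have e5 : r / 2 / 2 = r / 4 by field.
have n4 : 0 < N%:R `^ (r / 4) :> R by rewrite powR_gt0.
have cq : 0 < c `^ (r / 2) by rewrite powR_gt0.
rewrite e4 e5.
have -> : mz_const (r / 2) (centering_const (r / 2)) * N%:R `^ (r / 4) /
     (N%:R `^ (r / 4) * N%:R `^ (r / 4) * c `^ (r / 2)) =
   mz_const (r / 2) (centering_const (r / 2)) / (N%:R `^ (r / 4) * c `^ (r / 2)).
  by field; rewrite !gt_eqF.
by rewrite ler_wpM2r ?invr_ge0 ?mulr_ge0 ?powR_ge0// /tail_const lerDl.
Qed.

(** The factor [sqrt N ^-1] alone provides the decay in [N]: the average over [t]
    only needs a bounded moment. *)
Lemma tail_XD (hr : 4 <= r) (c : R) k i : 0 < c ->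
  (P [set w | (c < `|Psi x w (lshift N k) (rshift p i)|)%R] <=
   (tail_const / (N%:R `^ (r / 4) * c `^ (r / 2)))%:E)%E.
Proof.
move=> c0; have q2 : 2 <= r / 2 by lra.
have N0' : 0 < N%:R :> R by rewrite ltr0n.
pose f w := T%:R^-1 * \sum_t x i t k w.
have mf : measurable_fun setT f.
  by apply: measurable_funM => //; apply: measurable_sum => t.
have hx t := @integrable_powR_le _ _ _ P (x i t k) (r / 2) r ltac:(lra)
  (measurable_funP (x i t k)) (covariate_moment i t k).1.
have [fi hf] : P.-integrable setT (EFin \o (fun w => `|f w| `^ (r / 2))) /\
    \int[P]_w `|f w| `^ (r / 2) <= 2.
  apply: moment_mean_le => //; first by lra.
  - by move=> t; case: (hx t).
  - move=> t; apply: (le_trans (hx t).2).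
    by rewrite -[leRHS]/(1 + 1) lerD2l; case: (covariate_moment i t k).
have -> : [set w | c < `|Psi x w (lshift N k) (rshift p i)|] =
    [set w | c < `|(Num.sqrt N%:R)^-1 * f w|].
  by apply/seteqP; split=> w /=; rewrite Psi_XD.
have sN : 0 < Num.sqrt N%:R :> R by rewrite sqrtr_gt0.
apply: (le_trans (scaled_tail q2 c0 sN mf fi hf)); rewrite lee_fin.
have -> : Num.sqrt N%:R `^ (r / 2) = N%:R `^ (r / 4) :> R.
  by rewrite -powR12_sqrt ?ler0n// -powRrM; congr (_ `^ _); field.
rewrite ler_wpM2r ?invr_ge0 ?mulr_ge0 ?powR_ge0// /tail_const lerDr.
by apply: mz_const_ge0 => //; exact: centering_const_ge0.
Qed.

End PanelTails.

(** * The two probability bounds *)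

(** The factors common to [lambda] and [sqrt N * mu] cancel, leaving the ratio
    [(p / N) ^ (1 / r)]. *)
Lemma mNT_powR (R : realType) (N T p : nat) (r a M : R) :
  (0 < N)%N -> (0 < T)%N -> (0 < p)%N -> 0 < r -> 0 < a -> 0 < M ->
  mNT N (4 * a * p%:R `^ r^-1 * Num.sqrt (N * T)%:R * M)
    (4 * a * N%:R `^ r^-1 * Num.sqrt T%:R * M) `^ r =
  Num.max (p%:R / N%:R) (N%:R / p%:R).
Proof.
move=> N0 T0 p0 r0 a0 M0.
have Nr : 0 < N%:R :> R by rewrite ltr0n.
have pr : 0 < p%:R :> R by rewrite ltr0n.
have sT : 0 < Num.sqrt T%:R :> R by rewrite sqrtr_gt0 ltr0n.
have sN : 0 < Num.sqrt N%:R :> R by rewrite sqrtr_gt0.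
have ratio (u v : R) : 0 < u -> 0 < v -> (u / v) `^ r^-1 = u `^ r^-1 / v `^ r^-1.
  move=> u0 v0; apply: (mulIf (lt0r_neq0 (powR_gt0 r^-1 v0))).
  rewrite -powRM ?divr_ge0 ?(ltW u0) ?(ltW v0)// !divfK// gt_eqF// powR_gt0//.
have root (u : R) : 0 < u -> (u `^ r^-1) `^ r = u.
  by move=> u0; rewrite -powRrM mulVf ?gt_eqF// powRr1// ltW.
have pN := powR_gt0 r^-1 Nr; have pp := powR_gt0 r^-1 pr.
rewrite /mNT natrM sqrtrM ?ler0n//.
have -> : 4 * a * p%:R `^ r^-1 * (Num.sqrt N%:R * Num.sqrt T%:R) * M /
    (Num.sqrt N%:R * (4 * a * N%:R `^ r^-1 * Num.sqrt T%:R * M)) =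
    (p%:R / N%:R) `^ r^-1.
  by rewrite ratio//; field; rewrite !gt_eqF.
have -> : Num.sqrt N%:R * (4 * a * N%:R `^ r^-1 * Num.sqrt T%:R * M) /
    (4 * a * p%:R `^ r^-1 * (Num.sqrt N%:R * Num.sqrt T%:R) * M) =
    (N%:R / p%:R) `^ r^-1.
  by rewrite ratio//; field; rewrite !gt_eqF.
have u0 : 0 < p%:R / N%:R :> R by rewrite divr_gt0.
have v0 : 0 < N%:R / p%:R :> R by rewrite divr_gt0.
have mono (u v : R) : 0 < u -> u <= v -> u `^ r^-1 <= v `^ r^-1.
  move=> u0' uv; apply: ge0_ler_powR; rewrite ?nnegrE ?invr_ge0 ?(ltW r0) ?(ltW u0')//.
  exact: le_trans (ltW u0') uv.
have [uv|/ltW vu] := leP (p%:R / N%:R : R) (N%:R / p%:R).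
  by rewrite max_r ?root// mono.
by rewrite max_l ?root// mono.
Qed.

Lemma measurable_bigmax {R : realType} {d : measure_display} {Omega : measurableType d}
   (I : Type) (s : seq I) (f : I -> Omega -> R) :
  (forall i, measurable_fun setT (f i)) ->
  measurable_fun setT (fun w => \big[Num.max/0]_(i <- s) f i w).
Proof.
move=> mf; elim: s => [|i s IH].
  by under eq_fun do rewrite big_nil; exact: measurable_cst.
by under eq_fun do rewrite big_cons; exact: measurable_maxr.
Qed.

Section EventBounds.
Context {R : realType} {d : measure_display} {Omega : measurableType d}.
Variable P : probability Omega R.
Variables (N T p : nat).
Hypotheses (N0 : (0 < N)%N) (T0 : (0 < T)%N) (p0 : (0 < p)%N).
Variable x : 'I_N -> 'I_T -> 'I_p -> {RV P >-> R}.
Variables (s1 s2 : nat) (lambda mu : R).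
Hypotheses (lambda0 : 0 < lambda) (mu0 : 0 < mu).

Local Notation kap := (kappa2 T s1 s2 lambda mu (Gamma x)).
Local Notation thr := (kap / (32 * (s1 + s2)%:R * mNT N lambda mu ^+ 2)).
Local Notation Bt := (Btilde x s1 s2 lambda mu).

Lemma measurable_Btilde : measurable Bt.
Proof.
apply: measurable_set_le; apply: measurable_bigmax => ij.
apply: measurableT_comp => //; apply: measurable_funB => //.
exact: measurable_Psi.
Qed.

(** On the event, [kappa2_cone_perturb] applies with the threshold as [e], and the
    loss is exactly one half of the restricted eigenvalue of [Gamma].  If
    [s1 + s2 = 0] both restricted eigenvalues are [0]. *)
Lemma Btilde_sub : Bt `<=` [set w | kap / 2 <= kappa2 T s1 s2 lambda mu (Psi x w)].
Proof.
move=> w /= hw.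
have [s0|s0] := posnP (s1 + s2).
  by rewrite !kappa2_eq0// mul0r.
have h i j : `|Psi x w i j - Gamma x i j| <= thr.
  exact: (le_trans (le_bigmax 0
    (fun ij => `|Psi x w ij.1 ij.2 - Gamma x ij.1 ij.2|) (i, j)) hw).
have e0 : 0 <= thr.
  exact: le_trans (normr_ge0 _) (h (lshift N (Ordinal p0)) (lshift N (Ordinal p0))).
have h' i j : `|Gamma x i j - Psi x w i j| <= thr by rewrite distrC.
have := kappa2_cone_perturb s1 s2 N0 T0 lambda0 mu0 e0 h'.
have m0 : 0 < mNT N lambda mu by exact: mNT_gt0.
have sr : 0 < (s1 + s2)%:R :> R by rewrite ltr0n.
have -> : thr * (16 * (s1 + s2)%:R * mNT N lambda mu ^+ 2) = kap / 2.
  move: (kap) ((s1 + s2)%:R : R) sr (mNT N lambda mu) m0 => k u u0 v v0.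
  by field; rewrite !gt_eqF.
lra.
Qed.

Lemma Btilde_le : (P Bt <= P [set w | kap / 2 <= kappa2 T s1 s2 lambda mu (Psi x w)]%R)%E.
Proof.
rewrite le_measure ?inE//; [exact: measurable_Btilde | | exact: Btilde_sub].
by apply: measurable_kappa2_ge => i j; exact: measurable_Psi.
Qed.

(** Union bound.  The deviation matrix is symmetric and vanishes on the block of
    the individual effects, which leaves [p ^ 2 + N p] events. *)
Lemma Btilde_prob_ge (tau : R) : 0 < thr ->
  (forall k l, (P [set w | (thr < `|Psi x w (lshift N k) (lshift N l) -
     Gamma x (lshift N k) (lshift N l)|)%R] <= tau%:E)%E) ->
  (forall k i,
     (P [set w | (thr < `|Psi x w (lshift N k) (rshift p i)|)%R] <= tau%:E)%E) ->
  ((1 - (p ^ 2 + N * p)%:R * tau)%:E <= P Bt)%E.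
Proof.
move=> t0 h1 h2.
pose A1 (kl : 'I_p * 'I_p) := [set w | thr < `|Psi x w (lshift N kl.1) (lshift N kl.2) -
     Gamma x (lshift N kl.1) (lshift N kl.2)|].
pose A2 (ki : 'I_p * 'I_N) := [set w | thr < `|Psi x w (lshift N ki.1) (rshift p ki.2)|].
have mA1 kl : measurable (A1 kl).
  apply: measurable_set_gt; apply: measurableT_comp => //.
  by apply: measurable_funB => //; exact: measurable_Psi.
have mA2 ki : measurable (A2 ki).
  by apply: measurable_set_gt; apply: measurableT_comp => //; exact: measurable_Psi.
pose U1 := \bigcup_(kl in [set: 'I_p * 'I_p]) A1 kl.
pose U2 := \bigcup_(ki in [set: 'I_p * 'I_N]) A2 ki.
have mU1 : measurable U1 by apply: fin_bigcup_measurable.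
have mU2 : measurable U2 by apply: fin_bigcup_measurable.
have hU1 : (P U1 <= ((p ^ 2)%:R * tau)%:E)%E.
  have := union_bound mA1 (fun kl => h1 kl.1 kl.2).
  by rewrite card_prod !card_ord.
have hU2 : (P U2 <= ((N * p)%:R * tau)%:E)%E.
  have := union_bound mA2 (fun ki => h2 ki.1 ki.2).
  by rewrite card_prod !card_ord [(p * N)%N]mulnC.
have mU : measurable (U1 `|` U2) by exact: measurableU.
have hU : (P (U1 `|` U2) <= ((p ^ 2 + N * p)%:R * tau)%:E)%E.
  apply: (le_trans (measureU2 P mU1 mU2)); rewrite natrD mulrDl EFinD.
  exact: leeD.
have sub : ~` (U1 `|` U2) `<=` Bt.
  move=> w nU; apply: bigmax_le; first exact: ltW.
  move=> [i j] _ /=; rewrite leNgt; apply/negP => hij; apply: nU; move: hij.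
  case: (split_ordP i) => k ->; case: (split_ordP j) => l ->.
  - by move=> hij; left; exists (k, l).
  - by rewrite Gamma_XD subr0 => hij; right; exists (k, l).
  - by rewrite Gamma_DX Psi_DX// subr0 => hij; right; exists (l, k).
  - by rewrite Gamma_DD Psi_DD// subrr normr0 ltNge (ltW t0).
have : (P (~` (U1 `|` U2)) <= P Bt)%E.
  by rewrite le_measure ?inE//; [exact: measurableC | exact: measurable_Btilde].
apply: le_trans; rewrite probability_setC// EFinB.
exact: leeB.
Qed.

End EventBounds.

Theorem lemma6 (R : realType) (r : R) (hr : 2 <= r) :
  exists Dr : R,
  forall (d : measure_display) (Omega : measurableType d)
    (P : probability Omega R) (N T p : nat)
    (hN : (0 < N)%N) (hT : (0 < T)%N) (hp : (0 < p)%N)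
    (x : 'I_N -> 'I_T -> 'I_p -> {RV P >-> R})
    (eps y : 'I_N -> 'I_T -> {RV P >-> R})
    (beta : 'cV[R]_p) (c : 'cV[R]_N) (a : nat -> nat -> R),
  let i1 : 'I_N := Ordinal hN in
  let s1 := #|supp beta| in
  let s2 := #|supp c| in
  let lambda := lambdaNT p eps i1 r (a N T) in
  let mu := muNT eps i1 r (a N T) in
  let kappa2Gamma := kappa2 T s1 s2 lambda mu (Gamma x) in
  let kappa : R := Num.sqrt kappa2Gamma in
  let B := Btilde x s1 s2 lambda mu in
  let K := [set w | kappa2Gamma / 2 <= kappa2 T s1 s2 lambda mu (Psi x w)] in
  let bound : R :=
    1 - Dr * ((p ^ 2 + N * p)%:R * (s1 + s2)%:R `^ (r / 2) *
              Num.max (p%:R / N%:R) (N%:R / p%:R)) /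
        (kappa `^ r * N%:R `^ (r / 4)) in
  panel_model x eps y beta c ->
  assumption_A1 x eps ->
  assumption_A2a x eps i1 r ->
  (forall n t, 0 < a n t) ->
  0 < max_normL_eps eps i1 r ->
  (P B <= P K)%E /\ (0 < kappa -> (bound%:E <= P B)%E).
Proof.
(* For [4 <= r], [32] is the constant in the threshold of the event. *)
pose Dr : R := if r < 4 then 2 `^ (r / 2) else tail_const r * 32 `^ (r / 2).
exists Dr => d Omega P N T p hN hT hp x eps y beta c a.
move=> i1 s1 s2 lambda mu k2 kappa B K bound.
move=> _ hA1 hA2 a0 M0.
have r0 : 0 < r by lra.
have Nr : 0 < N%:R :> R by rewrite ltr0n.
have pr : 0 < p%:R :> R by rewrite ltr0n.
have lambda0 : 0 < lambda.
  by rewrite /lambda /lambdaNT !mulr_gt0 ?powR_gt0// sqrtr_gt0 ltr0n muln_gt0 hN.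
have mu0 : 0 < mu.
  by rewrite /mu /muNT !mulr_gt0 ?powR_gt0// sqrtr_gt0 ltr0n.
split; first exact: Btilde_le.
rewrite /kappa sqrtr_gt0 => k20.
have s0 : (0 < s1 + s2)%N.
  rewrite lt0n; apply/eqP => s0; move: k20.
  by rewrite /k2 kappa2_eq0// ltxx.
have sr : 0 < (s1 + s2)%:R :> R by rewrite ltr0n.
have kE : kappa `^ r = k2 `^ (r / 2).
  rewrite /kappa -powR12_sqrt ?(ltW k20)// -powRrM mulrC; congr (_ `^ _).
set mx := Num.max (p%:R / N%:R) (N%:R / p%:R) in bound *.
have mxE : mNT N lambda mu `^ r = mx by rewrite /mNT; exact: mNT_powR.
have m0 : 0 < mNT N lambda mu by exact: mNT_gt0.
have mx0 : 0 < mx by rewrite -mxE powR_gt0.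
set A : R := (p ^ 2 + N * p)%:R in bound *.
set sq := (s1 + s2)%:R `^ (r / 2) in bound *.
have kq0 : 0 < k2 `^ (r / 2) by rewrite powR_gt0.
have nq0 : 0 < N%:R `^ (r / 4) :> R by rewrite powR_gt0.
have sq0 : 0 < sq by rewrite powR_gt0.
rewrite /bound kE /Dr; case: ifPn => [r4|]; last rewrite -leNgt => r4.
  (* Low moments: the lower bound is at most zero. *)
  apply: (@le_trans _ _ 0%E); last exact: measure_ge0.
  rewrite lee_fin subr_le0 ler_pdivlMr ?mulr_gt0// mul1r.
  have k22 : k2 <= 2.
    by apply: kappa2_le_diag => // j; exact: (Gamma_diag_le2 hN hT hA1 hA2 hr).
  have h1 : k2 `^ (r / 2) <= 2 `^ (r / 2).
    by apply: ge0_ler_powR; rewrite ?nnegrE ?(ltW k20)//; lra.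
  have h2 : N%:R `^ (r / 4) <= N%:R :> R.
    by apply: ler1_powR; [rewrite ler1n | lra].
  have h3 : 1 <= sq.
    rewrite -(powRr0 (s1 + s2)%:R); apply: ler_powR; last by lra.
    by rewrite ler1n.
  have h4 : N%:R <= A * mx.
    apply: (@le_trans _ _ ((N%:R * p%:R) * (N%:R / p%:R))).
      have -> : N%:R * p%:R * (N%:R / p%:R) = N%:R * N%:R :> R by field; rewrite gt_eqF.
      by rewrite ler_peMr ?ler0n// ler1n.
    apply: ler_pM; rewrite ?mulr_ge0 ?invr_ge0 ?ler0n//.
      by rewrite -natrM ler_nat leq_addl.
    by rewrite /mx le_max lexx orbT.
  apply: ler_pM; rewrite ?powR_ge0//.
  apply: (le_trans h2); apply: (le_trans h4).
  by rewrite mulrAC ler_peMr// mulr_ge0// ?ler0n// ltW.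
set thr := k2 / (32 * (s1 + s2)%:R * mNT N lambda mu ^+ 2).
have den0 : 0 < 32 * (s1 + s2)%:R * mNT N lambda mu ^+ 2.
  by rewrite !mulr_gt0// exprn_gt0.
have t0 : 0 < thr by rewrite divr_gt0.
have tE : thr `^ (r / 2) = k2 `^ (r / 2) / (32 `^ (r / 2) * sq * mx).
  have e : (32 * (s1 + s2)%:R * mNT N lambda mu ^+ 2) `^ (r / 2) =
    32 `^ (r / 2) * sq * mx.
    rewrite powRM ?mulr_ge0 ?exprn_ge0 ?(ltW m0)// powRM// -mxE.
    by rewrite -powR_mulrn ?(ltW m0)// -powRrM; congr (_ * _ `^ _); field.
  apply: (mulIf (lt0r_neq0 (powR_gt0 (r / 2) den0))).
  rewrite -powRM ?(ltW t0) ?(ltW den0)// {1}/thr !divfK ?gt_eqF//.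
  by rewrite e divfK// gt_eqF// !mulr_gt0// powR_gt0.
have q32 : 0 < 32 `^ (r / 2) :> R by rewrite powR_gt0.
pose tau := tail_const r / (N%:R `^ (r / 4) * thr `^ (r / 2)).
have := @Btilde_prob_ge _ _ _ P _ _ _ hN hT x s1 s2 lambda mu tau t0
  (fun k l => tail_XX hN hT hA1 hA2 r4 k l t0)
  (fun k i => tail_XD hN hT hA1 hA2 r4 k i t0).
apply: le_trans; rewrite lee_fin lerD2l lerN2 -/A /tau tE le_eqVlt; apply/orP; left.
by apply/eqP; field; rewrite !gt_eqF.
Qed.
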